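(* Let $f,g,h$ be continuously differentiable and twice continuously differentiable with respect to the variable $y$ around $(x^*,y^* )\in\mathbb{R}^n\times\mathbb{R}^m$ (in the sense stated in the context). Assume that the lower level problem $(P_{x^*})$ satisfies the Jacobian uniqueness conditions at $(y^*,\mu^*,\xi^* )$. Then the following statements are equivalent: (i) $(x^*,y^* )$ is a bi-local solution of (BP); (ii) $x^*$ is a local solution of (SP); (iii) $(x^*,y^*,\mu^*,\xi^* )$ is a local solution of (FP).
   Context: Data: $F,f:\mathbb{R}^n\times\mathbb{R}^m\to\mathbb{R}$, $H:\mathbb{R}^n\times\mathbb{R}^m\to\mathbb{R}^p$, $G:\mathbb{R}^n\times\mathbb{R}^m\to\mathbb{R}^q$, $h:\mathbb{R}^n\times\mathbb{R}^m\to\mathbb{R}^r$, $g:\mathbb{R}^n\times\mathbb{R}^m\to\mathbb{R}^s$. Let $\Phi=\{(x,y):H(x,y)=0,\ G(x,y)\le0\}$, $Y(x)=\{y\in\mathbb{R}^m:h(x,y)=0,\ g(x,y)\le0\}$. Problem $(P_x)$ is $\min_yf(x,y)$ s.t. $y\in Y(x)$, with solution set $S(x)$ and Lagrangian $\mathcal{L}(x;y,\mu,\xi)=f(x,y)+\mu^Th(x,y)+\xi^Tg(x,y)$. The bilevel problem (BP) is $\min F(x,y)$ s.t. $(x,y)\in\Phi$, $y\in S(x)$. $\mathcal{J}$ denotes Jacobians, $\boldsymbol{B}_\delta(z)$ the closed Euclidean ball, $\Pi_{\mathbb{R}^s_-}$ the Euclidean projection onto the nonpositive orthant of $\mathbb{R}^s$.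 Smoothness convention: ''continuously differentiable and twice continuously differentiable with respect to $y$ around $(x^*,y^* )$'' means that in a neighbourhood of $(x^*,y^* )$ the functions $f,g,h$ are $C^1$ and $\nabla_yf,\mathcal{J}_yg,\mathcal{J}_yh$ are $C^1$ as functions of $(x,y)$. Bi-local (optimal) solution of (BP): a point $(x^*,y^* )$ with $(x^*,y^* )\in\Phi$ and $y^*\in Y(x^* )$ for which there exist $\delta_0>0$ and a function $\eta:(0,\delta_0]\to(0,\infty)$ with $\eta(\delta)\to0$ as $\delta\to0$ such that for every $\delta\in(0,\delta_0]$: (a) $f(x^*,y^* )\le f(x^*,z)$ for all $z\in Y(x^* )\cap\boldsymbol{B}_{\eta(\delta)}(y^* )$; and (b) for every $(x,y)\in\Phi\cap[\boldsymbol{B}_\delta(x^* )\times\boldsymbol{B}_{\eta(\delta)}(y^* )]$ satisfying $y\in\operatorname{argmin}_z\{f(x,z):z\in Y(x)\cap\boldsymbol{B}_{\eta(\delta)}(y^* )\}$ one has $F(x^*,y^* )\le F(x,y)$. Jacobian uniqueness conditions of $(P_{x})$ at $(y,\mu,\xi)\in\mathbb{R}^m\times\mathbb{R}^r\times\mathbb{R}^s$: (a) KKT: $\nabla_y\mathcal{L}(x;y,\mu,\xi)=0$, $h(x,y)=0$, $\xi\ge0$, $g(x,y)\le0$, $\xi^Tg(x,y)=0$; (b) LICQ: the vectors $\nabla_yh_j(x,y)$, $j=1,\dots,r$, and $\nabla_yg_i(x,y)$, $i\in I_x(y):=\{i:g_i(x,y)=0\}$, are linearly independent; (c) strict complementarity: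 $\xi_i-g_i(x,y)>0$ for $i=1,\dots,s$; (d) second-order sufficiency: $\langle\nabla^2_{yy}\mathcal{L}(x;y,\mu,\xi)d_y,d_y\rangle>0$ for every nonzero $d_y$ in the critical cone $\{d_y\in\mathbb{R}^m:\mathcal{J}_yh(x,y)d_y=0,\ \nabla_yg_i(x,y)^Td_y\le0\ (i\in I_x(y)),\ \nabla_yf(x,y)^Td_y\le0\}$. Under these hypotheses a classical theorem of Robinson provides $\delta_1>0$, $\varepsilon_1>0$ and a continuously differentiable mapping $(y,\mu,\xi):\boldsymbol{B}_{\delta_1}(x^* )\to\boldsymbol{B}_{\varepsilon_1}(y^* )\times\boldsymbol{B}_{\varepsilon_1}(\mu^* )\times\boldsymbol{B}_{\varepsilon_1}(\xi^* )$ with value $(y^*,\mu^*,\xi^* )$ at $x^*$ such that the Jacobian uniqueness conditions of $(P_x)$ hold at $(y(x),\mu(x),\xi(x))$ for all $x\in\boldsymbol{B}_{\delta_1}(x^* )$. Problem (SP) (considered for $x$ near $x^*$, with this $y(\cdot)$): $\min_xF(x,y(x))$ s.t. $H(x,y(x))=0$, $G(x,y(x))\le0$. Problem (FP): $\min_{x,y,\mu,\xi}F(x,y)$ s.t. $H(x,y)=0$, $G(x,y)\le0$, $\nabla_y\mathcal{L}(x;y,\mu,\xi)=0$, $h(x,y)=0$, $g(x,y)-\Pi_{\mathbb{R}^s_-}(g(x,y)+\xi)=0$. Local solutions of (SP) and (FP) are local minimizers in the usual sense (feasibility included). *)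

(* Defs.v *)
From mathcomp Require Export all_boot all_order all_algebra.
From mathcomp Require Export all_classical all_reals all_analysis.

Set Implicit Arguments.
Unset Strict Implicit.
Unset Printing Implicit Defensive.

Import Order.TTheory GRing.Theory Num.Theory.
Export numFieldNormedType.Exports.

Local Open Scope classical_set_scope.
Local Open Scope ring_scope.

Definition dotp (R : realType) (k : nat) (u v : 'rV[R]_k) : R :=
  \sum_(i < k) u 0 i * v 0 i.

(* The norm of the library on 'rV[R]_k is the sup norm. *)
Definition enorm (R : realType) (k : nat) (u : 'rV[R]_k) : R :=
  Num.sqrt (dotp u u).

Definition eball (R : realType) (k : nat) (z : 'rV[R]_k) (d : R) :
    set 'rV[R]_k :=
  [set w | enorm (w - z) <= d].

Definition argmin (R : realType) (T : Type) (phi : T -> R) (A : set T) :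
    set T :=
  [set z | A z /\ forall w, A w -> phi z <= phi w].

Definition local_solution (R : realType) (T : topologicalType)
    (phi : T -> R) (A : set T) (z : T) : Prop :=
  A z /\ \forall w \near z, A w -> phi z <= phi w.

Definition nonpos_orthant (R : realType) (k : nat) : set 'rV[R]_k :=
  [set v | forall i, v 0 i <= 0].

(* The default value 0 is taken only if v has no nearest point in A. *)
Definition eproj (R : realType) (k : nat) (A : set 'rV[R]_k)
    (v : 'rV[R]_k) : 'rV[R]_k :=
  xget 0 (argmin (fun w => enorm (v - w)) A).

(* Continuity of the differential is required for each fixed direction v;
   between finite-dimensional spaces, the only ones used here, this is
   continuity in operator norm. *)
Definition C1_around (R : realType) (V W : normedModType R) (f : V -> W)
    (z : V) : Prop :=
  \forall z' \near z, differentiable f z' /\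
    forall v : V, {for z', continuous (fun w => 'd f w v)}.

Definition grad (R : realType) (k : nat) (phi : 'rV[R]_k -> R)
    (y : 'rV[R]_k) : 'rV[R]_k :=
  \row_j 'D_(delta_mx 0 j) phi y.

(* 'J acts on row vectors from the right:
   d *m hess phi y is the derivative of grad phi at y in direction d. *)
Definition hess (R : realType) (k : nat) (phi : 'rV[R]_k -> R)
    (y : 'rV[R]_k) : 'M[R]_k :=
  'J (grad phi) y.

Record bilevel (R : realType) (n m p q r s : nat) := Bilevel {
  upF : 'rV[R]_n -> 'rV[R]_m -> R;
  upH : 'rV[R]_n -> 'rV[R]_m -> 'rV[R]_p;
  upG : 'rV[R]_n -> 'rV[R]_m -> 'rV[R]_q;
  lowf : 'rV[R]_n -> 'rV[R]_m -> R;
  lowh : 'rV[R]_n -> 'rV[R]_m -> 'rV[R]_r;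
  lowg : 'rV[R]_n -> 'rV[R]_m -> 'rV[R]_s
}.

Definition Phi (R : realType) (n m p q r s : nat)
    (P : bilevel R n m p q r s) : set ('rV[R]_n * 'rV[R]_m) :=
  [set z | upH P z.1 z.2 = 0 /\ forall i, upG P z.1 z.2 0 i <= 0].

Definition Y (R : realType) (n m p q r s : nat)
    (P : bilevel R n m p q r s) (x : 'rV[R]_n) : set 'rV[R]_m :=
  [set y | lowh P x y = 0 /\ forall i, lowg P x y 0 i <= 0].

Definition lagrangian (R : realType) (n m p q r s : nat)
    (P : bilevel R n m p q r s) (x : 'rV[R]_n) (y : 'rV[R]_m)
    (mu : 'rV[R]_r) (xi : 'rV[R]_s) : R :=
  lowf P x y + dotp mu (lowh P x y) + dotp xi (lowg P x y).

Definition smooth_lower (R : realType) (n m p q r s : nat)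
    (P : bilevel R n m p q r s) (x : 'rV[R]_n) (y : 'rV[R]_m) : Prop :=
  [/\ C1_around (fun z : 'rV[R]_n * 'rV[R]_m => lowf P z.1 z.2) (x, y),
      C1_around (fun z : 'rV[R]_n * 'rV[R]_m => lowg P z.1 z.2) (x, y) &
      C1_around (fun z : 'rV[R]_n * 'rV[R]_m => lowh P z.1 z.2) (x, y)] /\
  [/\ C1_around (fun z : 'rV[R]_n * 'rV[R]_m => grad (lowf P z.1) z.2) (x, y),
      C1_around (fun z : 'rV[R]_n * 'rV[R]_m => 'J (lowg P z.1) z.2) (x, y) &
      C1_around (fun z : 'rV[R]_n * 'rV[R]_m => 'J (lowh P z.1) z.2) (x, y)].

Definition KKT (R : realType) (n m p q r s : nat)
    (P : bilevel R n m p q r s) (x : 'rV[R]_n) (y : 'rV[R]_m)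
    (mu : 'rV[R]_r) (xi : 'rV[R]_s) : Prop :=
  [/\ grad (fun z => lagrangian P x z mu xi) y = 0,
      lowh P x y = 0,
      forall i, 0 <= xi 0 i,
      forall i, lowg P x y 0 i <= 0 &
      dotp xi (lowg P x y) = 0].

Definition active (R : realType) (n m p q r s : nat)
    (P : bilevel R n m p q r s) (x : 'rV[R]_n) (y : 'rV[R]_m) : {set 'I_s} :=
  [set i | lowg P x y 0 i == 0].

Definition LICQ (R : realType) (n m p q r s : nat)
    (P : bilevel R n m p q r s) (x : 'rV[R]_n) (y : 'rV[R]_m) : Prop :=
  free ([seq grad (fun z => lowh P x z 0 j) y | j <- enum 'I_r] ++
        [seq grad (fun z => lowg P x z 0 i) y | i <- enum (active P x y)]).

Definition critical_cone (R : realType) (n m p q r s : nat)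
    (P : bilevel R n m p q r s) (x : 'rV[R]_n) (y : 'rV[R]_m) :
    set 'rV[R]_m :=
  [set d | [/\ d *m 'J (lowh P x) y = 0,
      forall i, i \in active P x y ->
        dotp (grad (fun z => lowg P x z 0 i) y) d <= 0 &
      dotp (grad (lowf P x) y) d <= 0]].

Definition jacobian_uniqueness (R : realType) (n m p q r s : nat)
    (P : bilevel R n m p q r s) (x : 'rV[R]_n) (y : 'rV[R]_m)
    (mu : 'rV[R]_r) (xi : 'rV[R]_s) : Prop :=
  [/\ KKT P x y mu xi,
      LICQ P x y,
      forall i, 0 < xi 0 i - lowg P x y 0 i &
      forall d, critical_cone P x y d -> d != 0 ->
        0 < dotp (d *m hess (fun z => lagrangian P x z mu xi) y) d].

Definition bilocal_solution (R : realType) (n m p q r s : nat)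
    (P : bilevel R n m p q r s) (xs : 'rV[R]_n) (ys : 'rV[R]_m) : Prop :=
  [/\ Phi P (xs, ys), Y P xs ys &
  exists (delta0 : R) (eta : R -> R),
    [/\ 0 < delta0,
        forall delta : R, 0 < delta <= delta0 -> 0 < eta delta,
        eta delta @[delta --> 0^'+] --> (0 : R) &
    forall delta : R, 0 < delta <= delta0 ->
      (forall z, (Y P xs `&` eball ys (eta delta)) z ->
         lowf P xs ys <= lowf P xs z) /\
      (forall x y,
         (Phi P `&` (eball xs delta `*` eball ys (eta delta))) (x, y) ->
         argmin (lowf P x) (Y P x `&` eball ys (eta delta)) y ->
         upF P xs ys <= upF P x y)]].

(* The functions ysol, musol, xisol are total, but only their values near
   the closed ball matter; being C1 on the closed ball is read as being C1
   on a neighbourhood of it. *)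
Definition solution_map (R : realType) (n m p q r s : nat)
    (P : bilevel R n m p q r s) (xs : 'rV[R]_n) (ys : 'rV[R]_m)
    (mus : 'rV[R]_r) (xis : 'rV[R]_s) (delta1 eps1 : R)
    (ysol : 'rV[R]_n -> 'rV[R]_m) (musol : 'rV[R]_n -> 'rV[R]_r)
    (xisol : 'rV[R]_n -> 'rV[R]_s) : Prop :=
  [/\ 0 < delta1, 0 < eps1,
      (ysol xs, musol xs, xisol xs) = (ys, mus, xis) &
  forall x, eball xs delta1 x ->
    [/\ eball ys eps1 (ysol x), eball mus eps1 (musol x),
        eball xis eps1 (xisol x),
        [/\ C1_around ysol x, C1_around musol x & C1_around xisol x] &
        jacobian_uniqueness P x (ysol x) (musol x) (xisol x)]].

Definition SP_feasible (R : realType) (n m p q r s : nat)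
    (P : bilevel R n m p q r s) (xs : 'rV[R]_n) (delta1 : R)
    (ysol : 'rV[R]_n -> 'rV[R]_m) : set 'rV[R]_n :=
  [set x | [/\ eball xs delta1 x, upH P x (ysol x) = 0 &
               forall i, upG P x (ysol x) 0 i <= 0]].

Definition SP_local_solution (R : realType) (n m p q r s : nat)
    (P : bilevel R n m p q r s) (xs : 'rV[R]_n) (delta1 : R)
    (ysol : 'rV[R]_n -> 'rV[R]_m) : Prop :=
  local_solution (fun x => upF P x (ysol x)) (SP_feasible P xs delta1 ysol) xs.

Definition FP_feasible (R : realType) (n m p q r s : nat)
    (P : bilevel R n m p q r s) :
    set ('rV[R]_n * 'rV[R]_m * 'rV[R]_r * 'rV[R]_s) :=
  [set w | let: (x, y, mu, xi) := w in
    [/\ upH P x y = 0,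
        forall i, upG P x y 0 i <= 0,
        grad (fun z => lagrangian P x z mu xi) y = 0,
        lowh P x y = 0 &
        lowg P x y - eproj (@nonpos_orthant R s) (lowg P x y + xi) = 0]].

Definition FP_local_solution (R : realType) (n m p q r s : nat)
    (P : bilevel R n m p q r s) (xs : 'rV[R]_n) (ys : 'rV[R]_m)
    (mus : 'rV[R]_r) (xis : 'rV[R]_s) : Prop :=
  local_solution
    (fun w : 'rV[R]_n * 'rV[R]_m * 'rV[R]_r * 'rV[R]_s =>
       let: (x, y, _, _) := w in upF P x y)
    (FP_feasible P) (xs, ys, mus, xis).

(* Main.v *)
From HB Require Import structures.
From mathcomp Require Import ring lra.
Require Import Defs.

(** Around the reference point the lower-level KKT conditions are the equations
    nabla_y L = 0, h = 0 and xi_i g_i = 0 for all i: a square system of class C1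
    in (y, mu, xi), with x as parameter ([kkt_map]). Under the Jacobian uniqueness
    conditions its partial Jacobian is injective
    ([jacobian_uniqueness_injective]), so the implicit function theorem
    ([implicit_function]) gives a C1 branch (y(x), mu(x), xi(x)) that contains all
    nearby KKT points. The conditions hold along the branch
    ([jacobian_uniqueness_near]), which proves that the solution map exists.

    The feasible points of (FP) near the reference point are therefore the points
    of the branch that satisfy the upper-level constraints, and (FP) is (SP)
    written in other variables ([SP_local_FP_local], [FP_local_SP_local]).

    For bi-local solutions the point is that y(x) is the only minimiser of f(x, _)
    over the feasible points of a ball around ys whose radius is independent of x
    ([strict_minimality]). As long as eta(delta) is below this radius, the argmin
    in the definition is y(x) alone. From a local solution of (SP) one obtains
    eta proportional to delta, because y is Lipschitz at xs ([SP_local_bilocal]);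
    conversely one small delta suffices ([bilocal_SP_local]).

    Both the stability of second-order sufficiency and the uniform minimality come
    from one compactness argument ([uniform_good_direction]): every unit direction
    at the reference point either moves h away from 0, or increases an active g_i,
    or increases f, or has positive curvature for the Lagrangian, and the
    alternative that holds for a direction persists on a neighbourhood that is
    the same for all directions. *)

Set Implicit Arguments.
Unset Strict Implicit.
Unset Printing Implicit Defensive.

Import Order.TTheory GRing.Theory Num.Theory.

Local Open Scope classical_set_scope.
Local Open Scope ring_scope.

(** * Differentials and maps of class C1 *)

Section Differentials.
Context {R : realType}.
Implicit Types U V W : normedModType R.

Lemma near_ball V (z : V) (Q : V -> Prop) :
  (\forall w \near z, Q w) ->
  exists2 d : R, 0 < d & forall w, `|w - z| < d -> Q w.
Proof.
move=> /nbhs_ballP[d /= d0 H]; exists d => // w wd.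
by apply: H; rewrite -ball_normE /= distrC.
Qed.

Lemma ball_near V (z : V) (Q : V -> Prop) (d : R) : 0 < d ->
  (forall w, `|w - z| < d -> Q w) -> \forall w \near z, Q w.
Proof.
move=> d0 H; apply/nbhs_ballP; exists d => // w.
by rewrite -ball_normE /= distrC; exact: H.
Qed.

Lemma segment_ball V (c y z : V) (e t : R) : `|y - c| < e -> `|z - c| < e ->
  0 <= t <= 1 -> `|y + t *: (z - y) - c| < e.
Proof.
move=> ye ze /andP[t0 t1].
have -> : y + t *: (z - y) - c = (1 - t) *: (y - c) + t *: (z - c).
  have -> : z - y = (z - c) - (y - c) by rewrite opprB addrA subrK.
  rewrite [t *: _ in LHS]scalerBr scalerBl scale1r.
  by rewrite addrAC -[RHS]addrA [- _ + _ in RHS]addrC.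
rewrite (le_lt_trans (ler_normD _ _))// !normrZ ger0_norm ?subr_ge0//.
rewrite (ger0_norm t0).
have : (1 - t) * `|y - c| <= (1 - t) * Num.max `|y - c| `|z - c|.
  by rewrite ler_wpM2l ?subr_ge0// le_max lexx.
have : t * `|z - c| <= t * Num.max `|y - c| `|z - c|.
  by rewrite ler_wpM2l// le_max lexx orbT.
have : Num.max `|y - c| `|z - c| < e by rewrite gt_max ye.
lra.
Qed.

Lemma is_diff_epsP V W (f : V -> W) (df : {linear V -> W}) (x : V) :
  continuous df ->
  (forall e : R, 0 < e -> \forall h \near (0 : V),
    `|f (h + x) - f x - df h| <= e * `|h|) ->
  is_diff x f df.
Proof.
move=> dfc dfe.
have fo : f \o shift x = cst (f x) + df +o_ 0 id.
  apply/eqaddoP => e e0; near=> h.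
  rewrite [X in `|X|](_ : _ = f (h + x) - f x - df h).
    by near: h; exact: dfe.
  by rewrite /= -[LHS]/(f (h + x) - (f x + df h)) opprD addrA.
have dE := diff_unique dfc fo.
by apply: DiffDef => //; apply/diff_locallyP; rewrite dE.
Unshelve. all: by end_near. Qed.

Lemma differentiable_eps V W (f : V -> W) (x : V) (e : R) :
  differentiable f x -> 0 < e ->
  \forall h \near (0 : V), `|f (h + x) - f x - 'd f x h| <= e * `|h|.
Proof.
move=> /diff_locally/eqaddoP/(_ e) H e0; have {}H := H e0.
near=> h.
rewrite [X in `|X|](_ : _ = (f \o shift x - (cst (f x) + 'd f x)) h).
  by near: h; exact: H.
by rewrite -[RHS]/(f (h + x) - (f x + 'd f x h)) opprD addrA.
Unshelve. all: by end_near. Qed.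

Lemma differentiable_locally_lipschitz V W (f : V -> W) (x : V) :
  differentiable f x ->
  exists2 k : R, 0 < k & \forall x' \near x, `|f x' - f x| <= k * `|x' - x|.
Proof.
move=> df; have [k k0 dk] := linear_lipschitz (diff_continuous df).
exists (1 + k); first by rewrite addr_gt0.
have := differentiable_eps df ltr01.
rewrite -[in X in X -> _](subrr x) => H.
have {H} : \forall x' \near x,
    `|f ((x' - x) + x) - f x - 'd f x (x' - x)| <= 1 * `|x' - x|.
  have : (fun x' : V => x' - x) @ x --> x - x.
    by apply: cvgB; [exact: cvg_id|exact: cvg_cst].
  by move=> /(_ _ H).
apply: filterS => x'; rewrite subrK => H.
rewrite -(subrK ('d f x (x' - x)) (f x' - f x)).
by rewrite (le_trans (ler_normD _ _))// mulrDl lerD.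
Qed.

(** The differential has to be known only near the point: maps that agree
    near [z'] have the same limit there. *)
Lemma C1_aroundI V W (f : V -> W) (df : V -> V -> W) (z : V) :
  (\forall z' \near z, is_diff z' f (df z') /\
    forall v : V, {for z', continuous (fun w => df w v)}) ->
  C1_around f z.
Proof.
move=> H; near=> z'.
have [fd cd] : is_diff z' f (df z') /\
  forall v : V, {for z', continuous (fun w => df w v)} by near: z'.
split => // v.
suff : 'd f w v @[w --> z'] --> 'd f z' v by [].
have -> : 'd f z' v = df z' v by rewrite diff_val.
apply: cvg_trans (cd v); apply: near_eq_cvg.
have : \forall w \near z', is_diff w f (df w) /\
    forall v : V, {for w, continuous (fun w => df w v)}.
  by near: z'; exact: near_join.
by apply: filterS => w [? _]; rewrite diff_val.
Unshelve. all: by end_near. Qed.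

Lemma C1_around_near V W (f : V -> W) (z : V) :
  C1_around f z -> \forall z' \near z, C1_around f z'.
Proof. exact: near_join. Qed.

Lemma C1_differentiable V W (f : V -> W) (z : V) :
  C1_around f z -> differentiable f z.
Proof. by move=> /nbhs_singleton[]. Qed.

Lemma C1_continuous V W (f : V -> W) (z : V) :
  C1_around f z -> {for z, continuous f}.
Proof. by move=> /C1_differentiable/differentiable_continuous. Qed.

Lemma C1_diff_continuous V W (f : V -> W) (z : V) :
  C1_around f z -> forall v : V, {for z, continuous (fun w => 'd f w v)}.
Proof. by move=> /nbhs_singleton[_]. Qed.

Lemma is_diff_lin V W (L : {linear V -> W}) (z : V) :
  continuous L -> is_diff z L L.
Proof.
by move=> Lc; apply: DiffDef; [exact: linear_differentiable|exact: diff_lin].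
Qed.

Lemma is_diff_lin_comp U V W (L : {linear V -> W}) (f : U -> V) (z : U) :
  continuous L -> differentiable f z -> is_diff z (L \o f) (L \o 'd f z).
Proof.
move=> Lc fd.
exact: (is_diff_comp (differentiableP fd) (is_diff_lin (f z) Lc)).
Qed.

Lemma diff_lin_comp U V W (L : {linear V -> W}) (f : U -> V) (z v : U) :
  continuous L -> differentiable f z -> 'd (L \o f) z v = L ('d f z v).
Proof.
by move=> Lc fd; rewrite (@diff_val _ _ _ _ _ _ _ (is_diff_lin_comp Lc fd)).
Qed.

Lemma is_diff_comp_lin U V W (L : {linear U -> V}) (f : V -> W) (z : U) :
  continuous L -> differentiable f (L z) ->
  is_diff z (f \o L) ('d f (L z) \o L).
Proof.
by move=> Lc fd; exact: (is_diff_comp (is_diff_lin z Lc) (differentiableP fd)).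
Qed.

Lemma C1_lin V W (f : {linear V -> W}) (z : V) : continuous f -> C1_around f z.
Proof.
move=> fc; apply: (@C1_aroundI _ _ _ (fun _ => f)); apply: nearW => z'; split.
  exact: is_diff_lin.
by move=> v; exact: cvg_cst.
Qed.

(** One-sided composition with a linear map: the general chain rule would
    ask for joint continuity of the differential in point and direction. *)
Lemma C1_lin_comp U V W (L : {linear V -> W}) (f : U -> V) (z : U) :
  continuous L -> C1_around f z -> C1_around (L \o f) z.
Proof.
move=> Lc fC; apply: (@C1_aroundI _ _ _ (fun w => L \o 'd f w)).
apply: filterS fC => z' [fd fc]; split.
  exact: is_diff_lin_comp.
by move=> v; apply: (continuous_comp (fc v)); exact: Lc.
Qed.

Lemma C1_comp_lin U V W (L : {linear U -> V}) (f : V -> W) (z : U) :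
  continuous L -> C1_around f (L z) -> C1_around (f \o L) z.
Proof.
move=> Lc fC; apply: (@C1_aroundI _ _ _ (fun w => 'd f (L w) \o L)).
have : \forall z' \near z, differentiable f (L z') /\
    forall v : V, {for L z', continuous (fun w => 'd f w v)}.
  exact: (Lc z _ fC).
apply: filterS => z' [fd fc]; split.
  exact: is_diff_comp_lin.
move=> v; have := fc (L v) => fc'.
by apply: (@continuous_comp _ _ _ L (fun w => 'd f w (L v))); first exact: Lc.
Qed.

Lemma C1_add V W (f g : V -> W) (z : V) :
  C1_around f z -> C1_around g z -> C1_around (f + g) z.
Proof.
move=> fC gC; apply: (@C1_aroundI _ _ _ (fun w v => 'd f w v + 'd g w v)).
apply: filterS2 fC gC => z' [fd fc] [gd gc].
split; first exact: (is_diffD (differentiableP fd) (differentiableP gd)).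
by move=> v; apply: cvgD; [exact: fc|exact: gc].
Qed.

Lemma C1_mul V (f g : V -> R) (z : V) :
  C1_around f z -> C1_around g z -> C1_around (f * g) z.
Proof.
move=> fC gC.
apply: (@C1_aroundI _ _ _ (fun w v => f w * 'd g w v + g w * 'd f w v)).
apply: filterS2 fC gC => z' [fd fc] [gd gc].
split; first exact: (is_diffM (differentiableP fd) (differentiableP gd)).
have fz := differentiable_continuous fd.
have gz := differentiable_continuous gd.
move=> v; apply: cvgD; apply: cvgM => //.
  exact: gc.
exact: fc.
Qed.

Lemma C1_cst V W (c : W) (z : V) : C1_around (cst c : V -> W) z.
Proof.
apply: (@C1_aroundI _ _ _ (fun _ => 0)); apply: nearW => z'; split.
  exact: is_diff_cst.
by move=> v; exact: cvg_cst.
Qed.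

Lemma C1_sum V W (I : Type) (s : seq I) (f : I -> V -> W) (z : V) :
  (forall i, C1_around (f i) z) -> C1_around (fun w => \sum_(i <- s) f i w) z.
Proof.
move=> fC; elim: s => [|i s IH].
  rewrite (_ : (fun _ => _) = cst 0); first exact: C1_cst.
  by apply/funext => w; rewrite big_nil.
rewrite (_ : (fun _ => _) = f i + (fun w => \sum_(i <- s) f i w)).
  exact: (C1_add (fC i) IH).
by apply/funext => w; rewrite big_cons.
Qed.

(** Named so that a linear structure can be attached to it. *)
Definition entry m n i j (M : 'M[R]_(m, n)) : R := M i j.

Lemma entry_is_linear m n i j : linear (@entry m n i j).
Proof. by move=> a M N; rewrite /entry !mxE. Qed.

HB.instance Definition _ m n i j := GRing.isLinear.Build R 'M[R]_(m, n) R _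
  (@entry m n i j) (@entry_is_linear m n i j).

Lemma entry_continuous m n i j : continuous (@entry m n i j).
Proof. by move=> x; exact: coord_continuous. Qed.

Lemma C1_coord V m n (f : V -> 'M[R]_(m, n)) z i j :
  C1_around f z -> C1_around (fun w => f w i j) z.
Proof. exact: (C1_lin_comp (@entry_continuous m n i j)). Qed.

Lemma is_diff_coord V m n (f : V -> 'M[R]_(m, n)) z i j :
  differentiable f z -> is_diff z (fun w => f w i j) (fun v => 'd f z v i j).
Proof. exact: (is_diff_lin_comp (@entry_continuous m n i j)). Qed.

Lemma C1_row V n (f : 'I_n -> V -> R) z :
  (forall i, C1_around (f i) z) -> C1_around (fun w => \row_i f i w) z.
Proof.
move=> fC.
rewrite (_ : (fun _ => _) = fun w => \sum_i (f i w *: delta_mx 0 i)); last first.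
  by apply/funext => w; rewrite [LHS]row_sum_delta; under eq_bigr do rewrite mxE.
apply: C1_sum => i.
have Ll : linear ( *:%R^~ (delta_mx 0 i) : R -> 'rV[R]_n).
  by move=> a b c; rewrite scalerDl scalerA.
pose L : {linear R -> 'rV[R]_n} := HB.pack ( *:%R^~ (delta_mx 0 i) : R -> 'rV[R]_n)
  (GRing.isLinear.Build _ _ _ _ _ Ll).
apply: (C1_lin_comp (L := L) _ (fC i)) => x; exact: scalel_continuous.
Qed.

Lemma C1_mul_trmx V n k (f : V -> 'rV[R]_n) (A : V -> 'M[R]_(k, n)) z :
  C1_around f z -> C1_around A z -> C1_around (fun w => f w *m (A w)^T) z.
Proof.
move=> fC AC.
rewrite (_ : (fun _ => _) =
  fun w => \row_j \sum_i (f w 0 i * A w j i)); last first.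
  apply/funext => w; apply/rowP => j; rewrite !mxE.
  by apply: eq_bigr => i _; rewrite mxE.
apply: C1_row => j; apply: C1_sum => i.
exact: (C1_mul (C1_coord 0 i fC) (C1_coord j i AC)).
Qed.

Lemma C1_row_mx V n k (f : V -> 'rV[R]_n) (g : V -> 'rV[R]_k) z :
  C1_around f z -> C1_around g z -> C1_around (fun w => row_mx (f w) (g w)) z.
Proof.
move=> fC gC; rewrite (_ : (fun _ => _) = fun w => \row_i
  match fintype.split i with inl j => f w 0 j | inr j => g w 0 j end); last first.
  by apply/funext => w; apply/rowP => j; rewrite !mxE.
by apply: C1_row => i; case: (fintype.split i) => j; exact: C1_coord.
Qed.

(** A plain function of point and direction: it hides the filter and the
    linear structure that ['d] carries, so that equal points can be exchanged
    by rewriting. *)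
Definition dif V W (f : V -> W) (z v : V) : W := 'd f z v.

Lemma difD V W (f : V -> W) z v v' : dif f z (v + v') = dif f z v + dif f z v'.
Proof. exact: linearD. Qed.

Lemma difZ V W (f : V -> W) z (a : R) v : dif f z (a *: v) = a *: dif f z v.
Proof. exact: linearZ. Qed.

Lemma is_diff_dif V W (f df : V -> W) z v : is_diff z f df -> dif f z v = df v.
Proof. by move=> H; rewrite /dif (@diff_val _ _ _ _ _ _ _ H). Qed.

Lemma dif_lin_comp U V W (L : {linear V -> W}) (f : U -> V) (z v : U) :
  continuous L -> differentiable f z -> dif (L \o f) z v = L (dif f z v).
Proof. exact: diff_lin_comp. Qed.

Lemma dif_coord V m n (f : V -> 'M[R]_(m, n)) z v i j :
  differentiable f z -> dif (fun w => f w i j) z v = dif f z v i j.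
Proof. by move=> fd; exact: (is_diff_dif _ (is_diff_coord i j fd)). Qed.

Lemma dif_coord_mul V k (f g : V -> 'rV[R]_k) z v i :
  differentiable f z -> differentiable g z ->
  dif (fun w => f w 0 i * g w 0 i) z v =
  f z 0 i * dif g z v 0 i + dif f z v 0 i * g z 0 i.
Proof.
move=> fd gd; rewrite [X in _ + X]mulrC.
exact: (is_diff_dif _ (is_diffM (is_diff_coord 0 i fd) (is_diff_coord 0 i gd))).
Qed.

Lemma C1_dif_continuous V W (f : V -> W) (z v : V) :
  C1_around f z -> {for z, continuous (fun w => dif f w v)}.
Proof. by move=> fC; exact: C1_diff_continuous. Qed.

Lemma mean_value V (f : V -> R) (z v : V) :
  (forall t : R, 0 <= t <= 1 -> differentiable f (z + t *: v)) ->
  exists2 c : R, 0 < c < 1 & f (z + v) - f z = 'd f (z + c *: v) v.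
Proof.
move=> fd; pose g (t : R) := f (z + t *: v).
have gd (t : R) : 0 <= t <= 1 -> is_diff t g (fun s => 'd f (z + t *: v) (s *: v)).
  move=> t01.
  have ? : is_diff t (fun s : R => z + s *: v) (fun s => s *: v).
    have H : is_diff t (fun s : R => z + s *: v) (0 + ( *:%R^~ v)) :=
      is_diffD (is_diff_cst z t) (is_diff_scalel t v).
    by rewrite add0r in H.
  have := fd _ t01 => /differentiableP ?.
  exact: (@is_diff_comp _ _ _ _ (fun s : R => z + s *: v) _ f).
have gder (t : R) : t \in `]0, 1[%R -> is_derive t 1 g ('d f (z + t *: v) v).
  rewrite in_itv /= => /andP[t0 t1].
  have dg : is_diff t g (fun s => 'd f (z + t *: v) (s *: v)).
    by apply: gd; rewrite !ltW.
  apply: DeriveDef; first exact/diff_derivable.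
  by rewrite deriveE// diff_val scale1r.
have gc : {within `[0, 1], continuous g}.
  apply: continuous_in_subspaceT => t; rewrite inE/= in_itv/= => t01.
  by have := gd _ t01 => ?; exact/differentiable_continuous.
have [c c01 E] := MVT ltr01 gder gc.
exists c; first by move: c01; rewrite in_itv.
by move: E; rewrite /g scale1r scale0r addr0 subr0 mulr1.
Qed.

End Differentials.

(** * Row vectors and partial differentials *)

Section RowVectors.
Context {R : realType}.

Lemma ler_row_norm n (v : 'rV[R]_n) i : `|v 0 i| <= `|v|.
Proof.
rewrite [leRHS]/Num.Def.normr/= mx_normrE.
exact: (le_bigmax _ (fun ij => `|v ij.1 ij.2|) (0, i)).
Qed.

Lemma row_norm_le n (v : 'rV[R]_n) (e : R) :
  0 <= e -> (forall i, `|v 0 i| <= e) -> `|v| <= e.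
Proof.
move=> e0 H; rewrite [leLHS]/Num.Def.normr/= mx_normrE.
by rewrite (bigmax_le _ e0)//= => -[i j] _ /=; rewrite ord1; exact: H.
Qed.

Lemma linear_rowE n (W : lmodType R) (L : {linear 'rV[R]_n -> W}) v :
  L v = \sum_j v 0 j *: L (delta_mx 0 j).
Proof.
rewrite {1}[v]row_sum_delta linear_sum; apply: eq_bigr => j _.
by rewrite linearZ.
Qed.

Lemma linear_row_continuous n (W : normedModType R)
  (L : {linear 'rV[R]_n -> W}) : continuous L.
Proof.
move=> z; apply: C1_continuous.
rewrite (_ : (L : _ -> _) = fun v => \sum_j v 0 j *: L (delta_mx 0 j)); last first.
  by apply/funext => v; exact: linear_rowE.
apply: C1_sum => j.
have Ll : linear ( *:%R^~ (L (delta_mx 0 j)) : R -> W).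
  by move=> a b c; rewrite scalerDl scalerA.
pose S : {linear R -> W} := HB.pack ( *:%R^~ (L (delta_mx 0 j)) : R -> W)
  (GRing.isLinear.Build _ _ _ _ _ Ll).
apply: (C1_lin_comp (L := S) (f := @entry R 1 n 0 j)).
  by move=> x; exact: scalel_continuous.
exact/C1_lin/entry_continuous.
Qed.

Lemma linear_inj_inverse n (B : {linear 'rV[R]_n -> 'rV[R]_n}) :
  (forall v, B v = 0 -> v = 0) ->
  exists M : 'M[R]_n, forall v, B v *m M = v /\ B (v *m M) = v.
Proof.
move=> Binj; exists (invmx (lin1_mx B)) => v.
have Bu : lin1_mx B \in unitmx.
  rewrite -row_free_unit -kermx_eq0; apply/eqP/row_matrixP => i; rewrite row0.
  by apply: Binj; rewrite -mul_rV_lin1 -row_mul mulmx_ker row0.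
by rewrite -[B v]mul_rV_lin1 -[B (_ *m _)]mul_rV_lin1 mulmxK// mulmxKV.
Qed.

Lemma is_diff_partial2 (X U W : normedModType R) (F : X * U -> W) x u :
  differentiable F (x, u) ->
  is_diff u (fun u' => F (x, u')) (fun v => 'd F (x, u) (0, v)).
Proof.
move=> /differentiableP dF.
have H : is_diff u (fun u' : U => (x, u')) (fun v => (0, v)) :=
  is_diff_pair (is_diff_cst x u) (is_diff_id u).
exact: (is_diff_comp H dF).
Qed.

Lemma is_diff_partial1 (X U W : normedModType R) (F : X * U -> W) x u :
  differentiable F (x, u) ->
  is_diff x (fun x' => F (x', u)) (fun v => 'd F (x, u) (v, 0)).
Proof.
move=> /differentiableP dF.
have H : is_diff x (fun x' : X => (x', u)) (fun v => (v, 0)) :=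
  is_diff_pair (is_diff_id x) (is_diff_cst u x).
exact: (is_diff_comp H dF).
Qed.

End RowVectors.

(** * The implicit function theorem *)

Section PairSlots.
Context {R : realType} (X U : normedModType R).

Definition inl0 (h : X) : (X * U)%type := (h, 0).
Definition inr0 (k : U) : (X * U)%type := (0, k).

Lemma inl0_is_linear : linear inl0.
Proof.
by move=> a b c; rewrite /inl0 -[RHS]/(a *: b + c, a *: 0 + 0) scaler0 addr0.
Qed.

Lemma inr0_is_linear : linear inr0.
Proof.
by move=> a b c; rewrite /inr0 -[RHS]/(a *: 0 + 0, a *: b + c) scaler0 addr0.
Qed.

HB.instance Definition _ := GRing.isLinear.Build R X (X * U)%type _ inl0
  inl0_is_linear.
HB.instance Definition _ := GRing.isLinear.Build R U (X * U)%type _ inr0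
  inr0_is_linear.

Lemma inl0_continuous : continuous inl0.
Proof. by move=> x; apply: cvg_pair; [exact: cvg_id|exact: cvg_cst]. Qed.

Lemma pair_inD (h : X) (k : U) : (h, k) = inl0 h + inr0 k.
Proof. by rewrite -[RHS]/(h + 0, 0 + k) addr0 add0r. Qed.

End PairSlots.

Section NearIdentity.
Context {R : realType}.

(** It suffices to control the basis vectors: every coordinate of [v] is at
    most [`|v|] in the sup norm, so the bound follows when each of the [N] basis
    vectors is moved by at most 1/(2(N+1)); N+1 instead of N covers N = 0. *)
Lemma diff_near_left_inverse (V : normedModType R) (N : nat)
    (iota : {linear 'rV[R]_N -> V}) (F : V -> 'rV[R]_N) (z : V) :
  C1_around F z -> (forall v, 'd F z (iota v) = v) ->
  \forall p \near z, C1_around F p /\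
    forall v, `|v - 'd F p (iota v)| <= 2^-1 * `|v|.
Proof.
move=> FC dF0; pose d : R := (2 * N.+1%:R)^-1.
have d0 : 0 < d by rewrite invr_gt0 mulr_gt0.
have H (j : 'I_N) : \forall p \near z,
    `|delta_mx 0 j - 'd F p (iota (delta_mx 0 j))| <= d.
  have Hc : 'd F p (iota (delta_mx 0 j)) @[p --> z] --> (delta_mx 0 j : 'rV[R]_N).
    rewrite -[X in _ --> X]dF0.
    exact: (@C1_diff_continuous _ _ _ _ _ FC (iota (delta_mx 0 j))).
  by move: Hc => /cvgrPdist_le; apply.
have Hall := filter_forall (nbhs_filter z) H.
apply: filterS2 Hall (C1_around_near FC) => p {}H FCp; split => // v.
pose L (v : 'rV[R]_N) := v - 'd F p (iota v).
have Ll : linear L.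
  by move=> a b c; rewrite /L (linearP iota) (linearP ('d F p)) scalerBr opprD addrACA.
pose Lp : {linear 'rV[R]_N -> 'rV[R]_N} :=
  HB.pack L (GRing.isLinear.Build _ _ _ _ _ Ll).
rewrite -[v - _]/(Lp v) linear_rowE.
apply: (le_trans (ler_norm_sum _ _ _)).
apply: (@le_trans _ _ (\sum_(j < N) `|v| * d)).
  apply: ler_sum => j _; rewrite normrZ ler_pM//; last exact: H.
  exact: ler_row_norm.
rewrite sumr_const card_ord -mulrnAr mulrC ler_wpM2r//.
rewrite /d invfM -mulrnAr ler_piMr// -[_ *+ _]mulr_natr mulrC.
by rewrite ler_pdivrMr// mul1r ler_nat.
Qed.

End NearIdentity.

Section ImplicitFunctionNormalized.
Context {R : realType} (X : normedModType R) (N : nat).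
Variables (F : X * 'rV[R]_N -> 'rV[R]_N) (x0 : X) (u0 : 'rV[R]_N).
Hypothesis FC : C1_around F (x0, u0).
Hypothesis F0 : F (x0, u0) = 0.
Hypothesis dF0 : forall v, 'd F (x0, u0) (0, v) = v.

Lemma left_inverse_box : exists2 e : R, 0 < e & forall x u,
  `|x - x0| < e -> `|u - u0| < e -> C1_around F (x, u) /\
  forall v, `|v - 'd F (x, u) (0, v)| <= 2^-1 * `|v|.
Proof.
have /nbhs_ballP[e /= e0 He] :=
  diff_near_left_inverse (iota := @inr0 R X 'rV[R]_N) FC dF0.
exists e => // x u xe ue.
by apply: He; split; rewrite -ball_normE /= distrC.
Qed.

(** The partial differential of [u - F (x, u)] is [v - 'd F (x, u) (0, v)], of
    norm at most half that of [v]; the mean value theorem applies to each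
    coordinate, which is enough for the sup norm. *)
Lemma box_contraction (e : R) :
  (forall x u, `|x - x0| < e -> `|u - u0| < e -> C1_around F (x, u) /\
    forall v, `|v - 'd F (x, u) (0, v)| <= 2^-1 * `|v|) ->
  forall x u u', `|x - x0| < e -> `|u - u0| < e -> `|u' - u0| < e ->
  `|(u - F (x, u)) - (u' - F (x, u'))| <= 2^-1 * `|u - u'|.
Proof.
move=> He x u u' xe ue ue'; apply: row_norm_le; first by rewrite mulr_ge0.
move=> i; pose g w := (w - F (x, w)) 0 i.
have gd w : `|w - u0| < e ->
    is_diff w g (fun v => (v - 'd F (x, w) (0, v)) 0 i).
  move=> we; have [FCw _] := He _ _ xe we.
  have Fd := is_diff_partial2 (C1_differentiable FCw).
  have idd := is_diffB (is_diff_id w) Fd.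
  have := is_diff_coord 0 i (@ex_diff _ _ _ _ _ _ _ idd).
  by rewrite diff_val.
have seg (t : R) : 0 <= t <= 1 -> `|u' + t *: (u - u') - u0| < e.
  exact: segment_ball.
have [c /andP[c0 c1] E] : exists2 c : R, 0 < c < 1 &
    g (u' + (u - u')) - g u' = 'd g (u' + c *: (u - u')) (u - u').
  by apply: mean_value => t t01; have := gd _ (seg _ t01) => ?.
have ce : `|u' + c *: (u - u') - u0| < e by apply: seg; rewrite !ltW.
have -> : ((u - F (x, u)) - (u' - F (x, u'))) 0 i = g u - g u'.
  by rewrite /g !mxE.
rewrite (addrC u') subrK in E; rewrite E.
have H := gd _ ce; rewrite (@diff_val _ _ _ _ _ _ _ H).
apply: le_trans (ler_row_norm _ _) _.
by have [_] := He _ _ xe ce; exact.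
Qed.

(** When the partial differential in [u] is the identity at the reference
    point, the zeros of [F (x, _)] are the fixed points of [u - F (x, u)]. For
    [x] near [x0] this map sends the closed ball of radius [e / 2] to itself and
    contracts it, so Banach's theorem gives exactly one zero there. *)
Lemma local_zero_exists : exists phi : X -> 'rV[R]_N, exists2 e : R, 0 < e &
  [/\ phi x0 = u0,
     (forall x u, `|x - x0| < e -> `|u - u0| < e -> C1_around F (x, u) /\
         forall v, `|v - 'd F (x, u) (0, v)| <= 2^-1 * `|v|),
     (\forall x \near x0,
       [/\ `|x - x0| < e, F (x, phi x) = 0 & `|phi x - u0| < e]) &
     forall x u, `|x - x0| < e -> `|u - u0| < e / 2 -> F (x, u) = 0 -> u = phi x].
Proof.
have [e e0 He] := left_inverse_box.
have ctr := box_contraction He.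
pose r := e / 2.
have r0 : 0 < r by rewrite divr_gt0.
have re : r < e by rewrite ltr_pdivrMr// ltr_pMr// ltr1n.
pose A x := [set u | `|u0 - u| <= r /\ F (x, u) = 0].
have uniq x u u' : `|x - x0| < e -> A x u -> A x u' -> u = u'.
  move=> xe [ur Fu] [ur' Fu'].
  have H : `|u - F (x, u) - (u' - F (x, u'))| <= 2^-1 * `|u - u'|.
    by apply: ctr => //; rewrite distrC (le_lt_trans _ re).
  rewrite Fu Fu' !subr0 in H.
  apply/eqP; rewrite -subr_eq0 -normr_le0; lra.
exists (fun x => xget u0 (A x)), e => //.
have A0 : A x0 u0 by split; rewrite // subrr normr0 ltW.
split => //.
- by apply: (uniq x0); rewrite ?subrr ?normr0//; exact: (xgetI _ A0).
- suff H : \forall x \near x0, `|x - x0| < e /\ A x !=set0.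
    apply: filterS H => x [xe [u Au]].
    have [Ar AF] : A x (xget u0 (A x)) := xgetI _ Au.
    by split => //; rewrite distrC (le_lt_trans Ar).
  have Fc : F (x, u0) @[x --> x0] --> (0 : 'rV[R]_N).
    rewrite -F0; apply: (@differentiable_continuous _ _ _ _ (fun x => F (x, u0))).
    by have H := is_diff_partial1 (C1_differentiable FC).
  have Fx : \forall x \near x0, `|F (x, u0)| <= r / 2.
    move/cvgrPdist_le : Fc => /(_ (r / 2))H.
    have {}H := H (divr_gt0 r0 (ltr0Sn _ _)).
    by apply: filterS H => x; rewrite sub0r normrN.
  have xe : \forall x \near x0, `|x - x0| < e.
    exact: (ball_near e0).
  apply: filterS2 Fx xe => x Fx xe; split => //.
  pose U := [set u | `|u0 - u| <= r].
  pose f u := u - F (x, u).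
  have ctr' u u' : U u -> U u' -> `|f u - f u'| <= 2^-1 * `|u - u'|.
    by move=> Uu Uu'; apply: ctr => //; rewrite distrC (le_lt_trans _ re).
  have Uu0 : U u0 by rewrite /U /= subrr normr0 ltW.
  have fU : set_fun U U f.
    move=> u Uu; rewrite /U /= -(subrKA (f u0)).
    have a := ctr' _ _ Uu0 Uu.
    have b : `|u0 - f u0| <= r / 2 by rewrite /f opprB addrC subrK.
    have c : `|u0 - u| <= r by [].
    rewrite (le_trans (ler_normD _ _))//; lra.
  pose f' : {fun U >-> U} := HB.pack f (isFun.Build _ _ _ _ _ fU).
  pose E : completeNormedModType R := HB.pack 'rV[R]_N.
  have [|||u Uu uf] := @banach_fixed_point R E U f'.
  - have h0 : 0 <= 2^-1 :> R by [].
    exists (NngNum h0); split; first by rewrite /= invf_lt1// ltr1n.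
    by move=> [u u'] [/= Uu Uu']; exact: ctr'.
  - rewrite (_ : U = closed_ball u0 r); first exact: closed_ball_closed.
    by rewrite closed_ballE.
  - by exists u0.
  exists u; split => //; apply/eqP.
  by move: uf => /= /eqP; rewrite -subr_eq0 opprB addrC subrK.
- move=> x u xe ur Fu.
  have Au : A x u by split => //; rewrite distrC ltW.
  by apply: (uniq x) => //; exact: (xgetI _ Au).
Qed.

End ImplicitFunctionNormalized.

Section ZeroMap.
Context {R : realType} (X : normedModType R) (N : nat).
Variables (F : X * 'rV[R]_N -> 'rV[R]_N) (x0 : X) (u0 : 'rV[R]_N).
Variables (phi : X -> 'rV[R]_N) (e : R).
Hypothesis box : forall x u, `|x - x0| < e -> `|u - u0| < e ->
  C1_around F (x, u) /\ forall v, `|v - 'd F (x, u) (0, v)| <= 2^-1 * `|v|.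

Definition zero_at (x : X) : Prop :=
  [/\ `|x - x0| < e, F (x, phi x) = 0 & `|phi x - u0| < e].

(** The contraction property at [w], applied to [phi w] and [phi x], bounds
    the increment of [phi] by twice [F (w, phi x)], which is differentiable in
    [w] and vanishes for [w = x]. *)
Lemma zero_at_lipschitz x : (\forall w \near x, zero_at w) ->
  exists2 k : R, 0 < k & \forall w \near x, `|phi w - phi x| <= k * `|w - x|.
Proof.
move=> zx; have [xe Fx phixe] := nbhs_singleton zx.
have [FC _] := box xe phixe.
have H := is_diff_partial1 (C1_differentiable FC).
have [k k0 lip] := differentiable_locally_lipschitz (@ex_diff _ _ _ _ _ _ _ H).
exists (2 * k); first by rewrite mulr_gt0.
apply: filterS2 zx lip => w [we Fw phiwe]; rewrite Fx subr0 => lip.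
have C := box_contraction box we phiwe phixe.
rewrite Fw subr0 opprB addrA in C.
have : `|phi w - phi x| <= `|phi w + F (w, phi x) - phi x| + `|F (w, phi x)|.
  have {1}-> : phi w - phi x = phi w + F (w, phi x) - phi x - F (w, phi x).
    by rewrite [RHS]addrAC addrK.
  exact: ler_normB.
lra.
Qed.

Lemma diff2_injective x u v : `|x - x0| < e -> `|u - u0| < e ->
  'd F (x, u) (0, v) = 0 -> v = 0.
Proof.
move=> xe ue dv; have [_ /(_ v)] := box xe ue; rewrite dv subr0 => H.
apply/eqP; rewrite -normr_le0; lra.
Qed.

(** Expand 0 = F (x + h, phi (x + h)) to first order. With k the increment of
    [phi], the differential of F at (h, k) is o(|h| + |k|), and k = O(h) by the
    Lipschitz bound; applying the inverse of the partial differential in [u]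
    leaves k = - M (dF (h, 0)) + o(h). *)
Lemma zero_at_diff x : (\forall w \near x, zero_at w) ->
  differentiable phi x /\ forall v, 'd F (x, phi x) (v, 'd phi x v) = 0.
Proof.
move=> zx; have [xe Fx phixe] := nbhs_singleton zx.
have [FC _] := box xe phixe.
have [K K0 lip] := zero_at_lipschitz zx.
have Fd := C1_differentiable FC; set p := (x, phi x) in FC Fd *.
pose dF : {linear (X * 'rV[R]_N)%type -> 'rV[R]_N} := 'd F p.
have [M MP] : exists M : 'M[R]_N, forall v,
    dF (inr0 X v) *m M = v /\ dF (inr0 X (v *m M)) = v.
  apply: (linear_inj_inverse (B := dF \o @inr0 R X 'rV[R]_N)) => v dv.
  exact: (diff2_injective xe phixe).
have dFc : continuous dF := diff_continuous Fd.
pose Mr : {linear 'rV[R]_N -> 'rV[R]_N} := mulmxr M.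
have Mc : continuous Mr by exact: linear_row_continuous.
pose df : {linear X -> 'rV[R]_N} :=
  (-%R : {linear 'rV[R]_N -> 'rV[R]_N}) \o Mr \o dF \o @inl0 R X 'rV[R]_N.
have dfc : continuous df.
  suff c1 : continuous (fun h => Mr (dF (inl0 _ h))).
    by move=> h; exact: (cvgN (c1 h)).
  move=> h.
  apply: (@continuous_comp _ _ _ (fun h => dF (inl0 _ h)) Mr); last exact: Mc.
  apply: (@continuous_comp _ _ _ (@inl0 R X 'rV[R]_N) dF); last exact: dFc.
  exact: inl0_continuous.
have [c c0 Mlip] := linear_lipschitz Mc.
have dphi : is_diff x phi df.
  apply: is_diff_epsP => // d d0.
  (* absorbs the norm c of M and the factor in |(h, k)| <= (1 + K) |h| *)
  pose d' := d / (c * (1 + K)).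
  have d'0 : 0 < d' by rewrite divr_gt0// mulr_gt0// addr_gt0.
  have [r /= r0 Fr] := (nbhs_ballP _ _).1 (differentiable_eps Fd d'0).
  have hsmall : \forall h \near (0 : X), `|h| < r / (1 + K).
    apply/nbhs_ballP; exists (r / (1 + K)) => /=; first by rewrite divr_gt0// addr_gt0.
    by move=> h; rewrite -ball_normE /= sub0r normrN.
  have shift0 : (fun h : X => h + x) @ (0 : X) --> x.
    by rewrite -[X in _ --> X]add0r; apply: cvgD; [exact: cvg_id|exact: cvg_cst].
  have lip0 := shift0 _ lip; have zx0 := shift0 _ zx.
  near=> h.
  have [_ Fhx _] : zero_at (h + x) by near: h.
  have hr : `|h| < r / (1 + K) by near: h.
  have : `|phi (h + x) - phi x| <= K * `|h + x - x| by near: h.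
  rewrite addrK; set k := phi (h + x) - phi x => kh.
  have hk : ball (0 : X * 'rV[R]_N) r (h, k).
    have h1 : `|h| * (1 + K) < r by rewrite -ltr_pdivlMr// addr_gt0.
    have h2 : 0 <= `|h| * K by rewrite mulr_ge0// ltW.
    split; rewrite -ball_normE /= sub0r normrN.
      by apply: le_lt_trans h1; rewrite mulrDr mulr1 lerDl.
    apply: le_lt_trans kh _; apply: le_lt_trans h1.
    by rewrite mulrDr mulr1 mulrC lerDr.
  have := Fr _ hk.
  have -> : (h, k) + p = (h + x, phi (h + x)) by rewrite -[LHS]/(h + x, k + phi x) subrK.
  rewrite Fhx Fx subr0 sub0r normrN.
  have -> : 'd F p (h, k) = dF (inl0 _ h) + dF (inr0 _ k).
    by rewrite pair_inD -/dF linearD.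
  move=> Fhk.
  have nhk : `|(h, k)| <= (1 + K) * `|h|.
    have h2 : 0 <= K * `|h| by rewrite mulr_ge0// ltW.
    rewrite prod_normE /= ge_max mulrDl mul1r lerDl h2 /=.
    by rewrite (le_trans kh)// lerDr.
  have -> : k - df h = Mr (dF (inl0 _ h) + dF (inr0 _ k)).
    rewrite linearD /=; have [-> _] := MP k.
    by rewrite opprK addrC.
  apply: le_trans (Mlip _) _.
  have : c * `|dF (inl0 _ h) + dF (inr0 _ k)| <= c * (d' * ((1 + K) * `|h|)).
    rewrite ler_wpM2l ?(ltW c0)//; apply: le_trans Fhk _.
    by rewrite ler_wpM2l ?(ltW d'0).
  suff -> : c * (d' * ((1 + K) * `|h|)) = d * `|h| by [].
  rewrite /d'; field.
  by rewrite !gt_eqF ?addr_gt0.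
split; first exact: (@ex_diff _ _ _ _ _ _ _ dphi).
move=> v; rewrite (@diff_val _ _ _ _ _ _ _ dphi) pair_inD -/dF linearD.
have -> : df v = - (dF (inl0 _ v) *m M) by [].
have [_ E] := MP (dF (inl0 _ v)).
by rewrite (linearN (@inr0 R X 'rV[R]_N)) (linearN dF) E subrr.
Unshelve. all: by end_near. Qed.

(** The difference q = 'd phi w v - 'd phi x v satisfies
    'd F (w, phi w) (0, q) = - 'd F (w, phi w) (v, 'd phi x v), and the right-hand
    side tends to 0 when [w] tends to [x]. Since q - 'd F (w, phi w) (0, q) has
    norm at most |q| / 2, q tends to 0 as well. *)
Lemma zero_at_diff_continuous x : (\forall w \near x, zero_at w) ->
  forall v, {for x, continuous (fun w => 'd phi w v)}.
Proof.
move=> zx v; have [xe Fx phixe] := nbhs_singleton zx.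
have [FC _] := box xe phixe.
have [phid phiv] := zero_at_diff zx.
have phic : {for x, continuous (fun w => (w, phi w))}.
  by apply: differentiable_continuous; exact: differentiable_pair.
pose k := 'd phi x v.
have dFc : 'd F (w, phi w) (v, k) @[w --> x] --> (0 : 'rV[R]_N).
  rewrite -[X in _ --> X](phiv v).
  apply: (@continuous_comp _ _ _ (fun w => (w, phi w)) (fun p => 'd F p (v, k))) => //.
  exact: (@C1_diff_continuous _ _ _ _ _ FC (v, k)).
suff : 'd phi w v @[w --> x] --> k by [].
apply/cvgrPdist_le => d d0.
have d20 : 0 < d / 2 by rewrite divr_gt0.
have small := (cvgrPdist_le _ _).1 dFc _ d20.
have zx' := near_join zx.
near=> w.
have zw : \forall w' \near w, zero_at w' by near: w.
have : `|0 - 'd F (w, phi w) (v, k)| <= d / 2.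
  near: w; exact: small.
rewrite sub0r normrN => Fsmall.
have [we Fw phiwe] := nbhs_singleton zw.
have [_ /(_ ('d phi w v - k)) boxw] := box we phiwe.
have [_ /(_ v) phiwv] := zero_at_diff zw.
have E : 'd F (w, phi w) (0, 'd phi w v - k) = - 'd F (w, phi w) (v, k).
  have -> : ((0, 'd phi w v - k) : X * 'rV[R]_N) = (v, 'd phi w v) - (v, k).
    by rewrite -[RHS]/(v - v, 'd phi w v - k) subrr.
  by rewrite (linearB ('d F (w, phi w))) phiwv sub0r.
rewrite E opprK in boxw; rewrite distrC.
have : `|'d phi w v - k| <=
    `|'d phi w v - k + 'd F (w, phi w) (v, k)| + `|'d F (w, phi w) (v, k)|.
  have {1}-> : 'd phi w v - k =
      'd phi w v - k + 'd F (w, phi w) (v, k) - 'd F (w, phi w) (v, k).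
    by rewrite addrK.
  exact: ler_normB.
lra.
Unshelve. all: by end_near. Qed.

Lemma zero_map_C1 : (\forall x \near x0, zero_at x) -> C1_around phi x0.
Proof.
move=> zx0; have zx0' := near_join zx0; apply: filterS zx0' => x zx; split.
  by have [] := zero_at_diff zx.
exact: zero_at_diff_continuous.
Qed.

End ZeroMap.

(** Composing [F] with the inverse of its partial differential at the reference
    point reduces to the case where this differential is the identity. The
    conclusion also records that the partial differential stays injective along
    the branch, which is how LICQ propagates to nearby points. *)
Theorem implicit_function (R : realType) (X : normedModType R) (N : nat)
    (F : X * 'rV[R]_N -> 'rV[R]_N) (x0 : X) (u0 : 'rV[R]_N) :
  C1_around F (x0, u0) -> F (x0, u0) = 0 ->
  (forall v, dif F (x0, u0) (0, v) = 0 -> v = 0) ->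
  exists phi : X -> 'rV[R]_N, exists2 e : R, 0 < e &
  [/\ phi x0 = u0, C1_around phi x0,
     (\forall x \near x0, F (x, phi x) = 0 /\
        forall v, dif F (x, phi x) (0, v) = 0 -> v = 0) &
     forall x u, `|x - x0| < e -> `|u - u0| < e -> F (x, u) = 0 -> u = phi x].
Proof.
move=> FC F0 Finj; set p0 := (x0, u0) in FC F0 Finj.
pose dF : {linear (X * 'rV[R]_N)%type -> 'rV[R]_N} := 'd F p0.
have [M MP] := linear_inj_inverse (B := dF \o @inr0 R X 'rV[R]_N) Finj.
pose Mr : {linear 'rV[R]_N -> 'rV[R]_N} := mulmxr M.
have Mc : continuous Mr by exact: linear_row_continuous.
have Minj v : Mr v = 0 -> v = 0.
  by move=> Mv0; have [_ <-] := MP v; rewrite -[v *m M]/(Mr v) Mv0 linear0.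
have GC : C1_around (Mr \o F) p0 by exact: C1_lin_comp.
have dG p v : differentiable F p -> 'd (Mr \o F) p v = Mr ('d F p v).
  exact: diff_lin_comp.
have G0 : (Mr \o F) p0 = 0 by rewrite -[LHS]/(Mr (F p0)) F0 linear0.
have dG0 v : 'd (Mr \o F) p0 (0, v) = v.
  rewrite dG; last exact: C1_differentiable.
  by have [] := MP v.
have [phi [e e0 [phi0 box zphi uniq]]] := local_zero_exists GC G0 dG0.
exists phi, (e / 2); first by rewrite divr_gt0.
split => //.
- exact: (zero_map_C1 box zphi).
- have Fd1 : \forall p \near p0, differentiable F p.
    by apply: filterS FC => p [].
  have phic : {for x0, continuous (fun w => (w, phi w))}.
    apply: differentiable_continuous; apply: differentiable_pair => //.
    exact/C1_differentiable/(zero_map_C1 box zphi).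
  have Fd2 : \forall x \near x0, differentiable F (x, phi x).
    by have := phic; rewrite /prop_for /continuous_at phi0 => /(_ _ Fd1).
  apply: filterS2 zphi Fd2 => x [xe Gx phixe] Fd; split; first exact: Minj.
  move=> v dFv; apply: (diff2_injective box xe phixe).
  have := dG (x, phi x) (0, v) Fd.
  by rewrite -[X in _ = Mr X]/(dif F (x, phi x) (0, v)) dFv linear0.
- move=> x u xe ue Fxu; apply: uniq => //.
    by rewrite (lt_le_trans xe)// ler_pdivrMr// ler_pMr// ler1n.
  by rewrite -[LHS]/(Mr (F (x, u))) Fxu linear0.
Qed.

(** * Uniformity over directions *)

Section UniformDirections.
Context {R : realType} (W : normedModType R) (k : nat).

(** By homogeneity only the unit sphere matters. Each of its points has a
    neighbourhood on which one member of the family is positive for all [w] in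
    some ball, and the sphere is compact, so one ball serves all directions. The
    member depends on [u] but not on [w]: this is what lets the mean value
    theorem be used along a whole segment. *)
Lemma uniform_direction (A : set (W -> 'rV[R]_k -> R)) (w0 : W) :
  (forall a u, A a -> 0 < a w0 u -> exists2 e : R, 0 < e & forall w u',
     `|w - w0| < e -> `|u' - u| < e -> 0 < a w u') ->
  (forall a w u (c : R), A a -> 0 < c -> 0 < a w (c *: u) -> 0 < a w u) ->
  (forall u, u != 0 -> exists2 a, A a & 0 < a w0 u) ->
  exists2 e : R, 0 < e & forall u, u != 0 ->
    exists2 a, A a & forall w, `|w - w0| < e -> 0 < a w u.
Proof.
move=> Aopen Acone Acov.
pose S := [set u : 'rV[R]_k | `|u| = 1].
have Sc : compact S.
  apply: bounded_closed_compact.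
    by exists 1; split => // M M1 u /= ->; exact: ltW.
  apply: (@preimage_closed _ _ (fun u : 'rV[R]_k => `|u|) [set 1]).
    by move=> u _; exact: norm_continuous.
  exact: closed_eq.
pose Q (e : R) (u : 'rV[R]_k) :=
  exists2 a, A a & forall w, `|w - w0| < e -> 0 < a w u.
have Qcov u : S u -> \forall u' \near u & e \near 0^'+, Q e u'.
  move=> u1; have u0 : u != 0 by rewrite -normr_eq0 u1 oner_eq0.
  have [a Aa au] := Acov _ u0; have [e e0 He] := Aopen _ _ Aa au.
  exists ([set u' | `|u' - u| < e], [set e' | e' < e]) => /=.
    split; last exact: nbhs_right_lt.
    exact: (ball_near (Q := fun u' => `|u' - u| < e) e0).
  move=> [u' e'] [/= ue' ee']; exists a => // w we.
  by apply: He => //; exact: lt_trans ee'.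
have H : \forall e \near (0 : R)^'+, S `<=` Q e.
  exact: ((compact_near_coveringP S).1 Sc R _ Q (at_right_proper_filter 0) Qcov).
have pos : \forall e \near (0 : R)^'+, 0 < e by exact: nbhs_right_gt.
have [e [e0 He]] := filter_ex (filterI pos H).
exists e => // u u0; have nu0 : 0 < `|u| by rewrite normr_gt0.
have [a Aa Ha] : Q e (`|u|^-1 *: u).
  by apply: He; rewrite /S /= normrZ normfV normr_id mulVf// gt_eqF.
exists a => // w we.
by apply: (Acone _ _ _ `|u|^-1 Aa); [rewrite invr_gt0|exact: Ha].
Qed.

End UniformDirections.

Lemma continuous_at_sum (R : realType) (V : normedModType R) n
    (f : 'I_n -> V -> R) (z : V) :
  (forall j, {for z, continuous (f j)}) ->
  {for z, continuous (fun w => \sum_j f j w)}.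
Proof.
move=> fc; apply: cvg_big; first exact: add_continuous.
by move=> j _; exact: fc.
Qed.

Section JointContinuity.
Context {R : realType} (W : normedModType R) (k : nat).

Lemma continuous_pos_box (a : W -> 'rV[R]_k -> R) w0 u :
  {for (w0, u), continuous (fun q : W * 'rV[R]_k => a q.1 q.2)} ->
  0 < a w0 u -> exists2 e : R, 0 < e & forall w u',
     `|w - w0| < e -> `|u' - u| < e -> 0 < a w u'.
Proof.
move=> ac au; have /cvgrPdist_lt/(_ _ au)/nbhs_ballP[e /= e0 He] := ac.
exists e => // w u' we ue.
have : `|a w0 u - a w u'| < a w0 u.
  by apply: (He (w, u')); split; rewrite -ball_normE /= distrC.
by rewrite ltr_norml => /andP[]; lra.
Qed.

(** Expanding [u] in the standard basis leaves finitely many maps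
    [dif phi w (iota (delta_mx 0 j))], each of them continuous in [w]. *)
Lemma dif_along_continuous (phi : W -> R) (iota : {linear 'rV[R]_k -> W}) w0 u :
  C1_around phi w0 ->
  {for (w0, u), continuous (fun q : W * 'rV[R]_k => dif phi q.1 (iota q.2))}.
Proof.
move=> phiC.
pose dphi j (w : W) : R := dif phi w (iota (delta_mx 0 j)).
have dphic j : {for w0, continuous (dphi j)} by exact: C1_dif_continuous.
rewrite (_ : (fun _ => _) =
    fun q : W * 'rV[R]_k => \sum_j q.2 0 j * dphi j q.1); last first.
  apply/funext => -[w v] /=.
  pose D : {linear 'rV[R]_k -> R} := 'd phi w \o iota.
  by rewrite -[LHS]/(D v) linear_rowE.
apply: continuous_at_sum => j; apply: cvgM.
  apply: (@continuous_comp _ _ _ snd (fun u : 'rV[R]_k => u 0 j)).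
    exact: cvg_snd.
  exact: coord_continuous.
apply: (@continuous_comp _ _ _ fst (dphi j)); first exact: cvg_fst.
exact: dphic.
Qed.

Lemma dif_form_continuous (psi : W -> 'rV[R]_k) (iota : {linear 'rV[R]_k -> W})
    w0 u : C1_around psi w0 ->
  {for (w0, u), continuous
    (fun q : W * 'rV[R]_k =>
       \sum_j dif (fun w => psi w 0 j) q.1 (iota q.2) * q.2 0 j)}.
Proof.
move=> psiC; apply: continuous_at_sum => j; apply: cvgM.
  exact/dif_along_continuous/C1_coord.
apply: (@continuous_comp _ _ _ snd (fun u : 'rV[R]_k => u 0 j)).
  exact: cvg_snd.
exact: coord_continuous.
Qed.

End JointContinuity.

(** * Gradients and Jacobians *)

Lemma is_diff_near_eq (R : realType) (V W : normedModType R) (f g : V -> W)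
    (df : V -> W) (z : V) :
  (\forall w \near z, f w = g w) -> is_diff z f df -> is_diff z g df.
Proof.
move=> fg [fd dfE]; rewrite -dfE.
apply: is_diff_epsP; first exact: diff_continuous.
move=> e e0; have feps := differentiable_eps fd e0.
have shift0 : (fun h : V => h + z) @ (0 : V) --> z.
  by rewrite -[X in _ --> X]add0r; apply: cvgD; [exact: cvg_id|exact: cvg_cst].
have fg0 := shift0 _ fg.
apply: filterS2 feps fg0 => h.
by rewrite (nbhs_singleton fg) => + <-.
Qed.

Lemma is_diff_affine (R : realType) (U V W : normedModType R)
    (L : {linear U -> V}) (f : V -> W) (z : V) (u : U) :
  continuous L -> differentiable f (z + L u) ->
  is_diff u (fun u' => f (z + L u')) ('d f (z + L u) \o L).
Proof.
move=> Lc fd.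
have H : is_diff u (fun u' => z + L u') (0 + (L : U -> V)) :=
  is_diffD (is_diff_cst z u) (is_diff_lin u Lc).
rewrite add0r in H.
exact: (is_diff_comp H (differentiableP fd)).
Qed.

Section Gradients.
Context {R : realType}.

Lemma dotpE k (u v : 'rV[R]_k) : dotp u v = (u *m v^T) 0 0.
Proof. by rewrite mxE; apply: eq_bigr => i _; rewrite mxE. Qed.

Lemma dotpC k (u v : 'rV[R]_k) : dotp u v = dotp v u.
Proof. by apply: eq_bigr => i _; rewrite mulrC. Qed.

Lemma dotp_mul k l (u : 'rV[R]_k) (d : 'rV[R]_l) (A : 'M[R]_(l, k)) :
  dotp u (d *m A) = dotp (u *m A^T) d.
Proof. by rewrite !dotpE trmx_mul mulmxA. Qed.

Lemma dotp_is_linear k (u : 'rV[R]_k) : linear (dotp u).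
Proof.
by move=> a v w; rewrite !dotpE linearP /= linearP /= !mxE.
Qed.

HB.instance Definition _ k (u : 'rV[R]_k) :=
  GRing.isLinear.Build R 'rV[R]_k R _ (dotp u) (dotp_is_linear u).

Lemma dotpDl k (u v w : 'rV[R]_k) : dotp (u + v) w = dotp u w + dotp v w.
Proof. by rewrite !dotpE mulmxDl mxE. Qed.

Lemma dotp_delta k (u : 'rV[R]_k) j : dotp u (delta_mx 0 j) = u 0 j.
Proof.
rewrite /dotp (bigD1 j)//= big1 ?addr0 ?mxE ?eqxx ?mulr1// => i ij.
by rewrite mxE (negbTE ij) andbF mulr0.
Qed.

Lemma dotp_grad k (phi : 'rV[R]_k -> R) y d :
  differentiable phi y -> dotp (grad phi y) d = 'd phi y d.
Proof.
move=> phid; rewrite [RHS]linear_rowE; apply: eq_bigr => j _.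
by rewrite mxE deriveE// mulrC.
Qed.

Lemma is_diff_grad k (phi : 'rV[R]_k -> R) y v :
  is_diff y phi (dotp v) -> grad phi y = v.
Proof.
move=> H; apply/rowP => j.
by rewrite mxE deriveE ?(@diff_val _ _ _ _ _ _ _ H) ?dotp_delta.
Qed.

Lemma mul_jacobian k l (phi : 'rV[R]_k -> 'rV[R]_l) y d :
  d *m 'J phi y = 'd phi y d.
Proof. exact: mul_rV_lin1. Qed.

Lemma dotp_grad_coord k l (phi : 'rV[R]_k -> 'rV[R]_l) y d j :
  differentiable phi y ->
  dotp (grad (fun z => phi z 0 j) y) d = (d *m 'J phi y) 0 j.
Proof.
move=> phid; have H := is_diff_coord 0 j phid.
by rewrite dotp_grad// (@diff_val _ _ _ _ _ _ _ H) mul_jacobian.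
Qed.

Lemma grad_coord k l (phi : 'rV[R]_k -> 'rV[R]_l) y j :
  differentiable phi y -> grad (fun z => phi z 0 j) y = (col j ('J phi y))^T.
Proof.
move=> phid; apply/rowP => i; rewrite -dotp_delta dotp_grad_coord//.
by rewrite -rowE !mxE.
Qed.

End Gradients.

(** * Coordinates on the space of x, y and the multipliers *)

Lemma pair_continuous (R : realType) (V U1 U2 : normedModType R)
    (f : V -> U1) (g : V -> U2) :
  continuous f -> continuous g -> continuous (fun w => (f w, g w)).
Proof. by move=> fc gc w; apply: cvg_pair; [exact: fc|exact: gc]. Qed.

Section Projections.
Context {R : realType} (n m r s : nat).

Local Notation U := 'rV[R]_(m + (r + s)).
Local Notation W := ('rV[R]_n * U)%type.

Definition pack (y : 'rV[R]_m) (mu : 'rV[R]_r) (xi : 'rV[R]_s) : U :=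
  row_mx y (row_mx mu xi).

Definition y_part (w : W) : 'rV[R]_m := lsubmx w.2.
Definition mu_part (w : W) : 'rV[R]_r := lsubmx (rsubmx w.2).
Definition xi_part (w : W) : 'rV[R]_s := rsubmx (rsubmx w.2).
Definition xy_part (w : W) : ('rV[R]_n * 'rV[R]_m)%type := (w.1, y_part w).
Definition yshift (d : 'rV[R]_m) : W := (0, pack d 0 0).

Lemma y_part_pack x y mu xi : y_part (x, pack y mu xi) = y.
Proof. by rewrite /y_part row_mxKl. Qed.

Lemma mu_part_pack x y mu xi : mu_part (x, pack y mu xi) = mu.
Proof. by rewrite /mu_part /= row_mxKr row_mxKl. Qed.

Lemma xi_part_pack x y mu xi : xi_part (x, pack y mu xi) = xi.
Proof. by rewrite /xi_part /= !row_mxKr. Qed.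

Lemma xy_part_pack x y mu xi : xy_part (x, pack y mu xi) = (x, y).
Proof. by rewrite /xy_part y_part_pack. Qed.

Lemma y_part_is_linear : linear y_part.
Proof. by move=> a v w; rewrite /y_part /= linearP. Qed.

Lemma mu_part_is_linear : linear mu_part.
Proof. by move=> a v w; apply/rowP => i; rewrite !mxE. Qed.

Lemma xi_part_is_linear : linear xi_part.
Proof. by move=> a v w; apply/rowP => i; rewrite !mxE. Qed.

HB.instance Definition _ := GRing.isLinear.Build R W 'rV[R]_m _ y_part y_part_is_linear.
HB.instance Definition _ := GRing.isLinear.Build R W 'rV[R]_r _ mu_part mu_part_is_linear.
HB.instance Definition _ := GRing.isLinear.Build R W 'rV[R]_s _ xi_part xi_part_is_linear.

Lemma xy_part_is_linear : linear xy_part.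
Proof.
move=> a v w; rewrite /xy_part (linearP y_part).
by rewrite -[RHS]/(a *: v.1 + w.1, a *: y_part v + y_part w).
Qed.

HB.instance Definition _ :=
  GRing.isLinear.Build R W ('rV[R]_n * 'rV[R]_m)%type _ xy_part xy_part_is_linear.

Lemma yshift_is_linear : linear yshift.
Proof.
move=> a v w; rewrite /yshift /pack row_mx0.
rewrite -[RHS]/(a *: 0 + 0, a *: row_mx v 0 + row_mx w 0) scaler0 addr0.
by rewrite scale_row_mx add_row_mx scaler0 addr0.
Qed.

HB.instance Definition _ := GRing.isLinear.Build R 'rV[R]_m W _ yshift yshift_is_linear.

Lemma snd_part_continuous k (L : {linear U -> 'rV[R]_k}) :
  continuous (fun w : W => L w.2).
Proof.
move=> w; apply: (@continuous_comp _ _ _ snd L); first exact: cvg_snd.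
exact: linear_row_continuous.
Qed.

Lemma y_part_continuous : continuous y_part.
Proof. exact: snd_part_continuous. Qed.

Lemma mu_part_continuous : continuous mu_part.
Proof. exact: (snd_part_continuous (L := lsubmx \o rsubmx)). Qed.

Lemma xi_part_continuous : continuous xi_part.
Proof. exact: (snd_part_continuous (L := rsubmx \o rsubmx)). Qed.

Lemma xy_part_continuous : continuous xy_part.
Proof.
apply: (pair_continuous (f := fst)); last exact: y_part_continuous.
by move=> w; exact: cvg_fst.
Qed.

Lemma yshift_continuous : continuous yshift.
Proof. exact: linear_row_continuous. Qed.

Lemma pack_box (e : R) (x x' : 'rV[R]_n) y y' mu mu' xi xi' :
  `|x' - x| < e -> `|y' - y| < e -> `|mu' - mu| < e -> `|xi' - xi| < e ->
  `|(x', pack y' mu' xi') - (x, pack y mu xi)| < e.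
Proof.
move=> xe ye mue xie; rewrite prod_normE /= gt_max xe /=.
rewrite /pack opp_row_mx opp_row_mx add_row_mx add_row_mx.
have row_mx_lt k l (a : 'rV[R]_k) (b : 'rV[R]_l) :
    `|a| < e -> `|b| < e -> `|row_mx a b| < e.
  move=> ae be; apply: (@le_lt_trans _ _ (Num.max `|a| `|b|)); last first.
    by rewrite gt_max ae.
  apply: row_norm_le; first by rewrite le_max normr_ge0.
  move=> i; rewrite mxE le_max; case: (fintype.split i) => j.
    by rewrite ler_row_norm.
  by rewrite ler_row_norm orbT.
by apply: (row_mx_lt) => //; exact: row_mx_lt.
Qed.

End Projections.

(** * The gradient of the Lagrangian *)

Section Boxes.
Context {R : realType} (X Y : normedModType R).

Definition box_near (x : X) (y : Y) (Q : X -> Y -> Prop) :=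
  exists2 e : R, 0 < e & forall x' y',
    `|x' - x| < e -> `|y' - y| < e -> Q x' y'.

Lemma box_nearP x y (Q : X * Y -> Prop) :
  (\forall z \near (x, y), Q z) -> box_near x y (fun x' y' => Q (x', y')).
Proof.
move=> /nbhs_ballP[e /= e0 He]; exists e => // x' y' xe ye.
by apply: He; split; rewrite -ball_normE /= distrC.
Qed.

Lemma box_near_and x y Q1 Q2 : box_near x y Q1 -> box_near x y Q2 ->
  box_near x y (fun x' y' => Q1 x' y' /\ Q2 x' y').
Proof.
move=> [e1 e10 H1] [e2 e20 H2]; exists (Num.min e1 e2); first by rewrite lt_min e10.
by move=> x' y'; rewrite !lt_min => /andP[? ?] /andP[? ?]; split; [exact: H1|exact: H2].
Qed.

Lemma C1_around_box (V : normedModType R) (f : X * Y -> V) x y :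
  C1_around f (x, y) -> box_near x y (fun x' y' => C1_around f (x', y')).
Proof. by move=> fC; apply: box_nearP; exact: C1_around_near. Qed.

End Boxes.

Section System.
Context {R : realType} (n m p q r s : nat) (P : bilevel R n m p q r s).

Local Notation U := 'rV[R]_(m + (r + s)).
Local Notation W := ('rV[R]_n * U)%type.
Local Notation y_part := (@y_part R n m r s).
Local Notation mu_part := (@mu_part R n m r s).
Local Notation xi_part := (@xi_part R n m r s).
Local Notation xy_part := (@xy_part R n m r s).
Local Notation yshift := (@yshift R n m r s).

Lemma smooth_near x y : smooth_lower P x y -> box_near x y (smooth_lower P).
Proof.
move=> [[/C1_around_box cf /C1_around_box cg /C1_around_box ch]
        [/C1_around_box cdf /C1_around_box cdg /C1_around_box cdh]].
have [e e0 He] := box_near_and (box_near_and cf (box_near_and cg ch))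
  (box_near_and cdf (box_near_and cdg cdh)).
exists e => // x' y' xe ye.
by have [[? [? ?]] [? [? ?]]] := He _ _ xe ye.
Qed.

Lemma lowf_differentiable x y : smooth_lower P x y -> differentiable (lowf P x) y.
Proof.
move=> [[/C1_differentiable fd _ _] _].
by have [] := is_diff_partial2 fd.
Qed.

Lemma lowg_differentiable x y : smooth_lower P x y -> differentiable (lowg P x) y.
Proof.
move=> [[_ /C1_differentiable gd _] _].
by have [] := is_diff_partial2 gd.
Qed.

Lemma lowh_differentiable x y : smooth_lower P x y -> differentiable (lowh P x) y.
Proof.
move=> [[_ _ /C1_differentiable hd] _].
by have [] := is_diff_partial2 hd.
Qed.

Lemma dif_xy_part (V : normedModType R) (phi : 'rV[R]_n * 'rV[R]_m -> V) w z v :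
  xy_part w = z -> differentiable phi z ->
  dif (phi \o xy_part) w v = dif phi z (xy_part v).
Proof.
move=> <- phid; have xyPc := @xy_part_continuous R n m r s.
exact: (is_diff_dif _ (is_diff_comp_lin xyPc phid)).
Qed.

Lemma dif_pack (V : normedModType R) (phi : 'rV[R]_n * 'rV[R]_m -> V)
    x y mu xi a b c : differentiable phi (x, y) ->
  dif (phi \o xy_part) (x, pack y mu xi) (0, pack a b c) =
  dif (fun y' => phi (x, y')) y a.
Proof.
move=> phid; rewrite (dif_xy_part _ (xy_part_pack x y mu xi) phid) xy_part_pack.
exact/esym/(is_diff_dif _ (is_diff_partial2 phid)).
Qed.

(** The gradient of the Lagrangian in y (see [grad_lagrangian]). *)
Definition lagr_grad x y mu xi : 'rV[R]_m :=
  grad (lowf P x) y + mu *m ('J (lowh P x) y)^T + xi *m ('J (lowg P x) y)^T.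

Definition lagr_gradW (w : W) : 'rV[R]_m := lagr_grad w.1 (y_part w) (mu_part w) (xi_part w).

Lemma lagrangian_is_diff x y mu xi : smooth_lower P x y ->
  is_diff y (fun z => lagrangian P x z mu xi) (dotp (lagr_grad x y mu xi)).
Proof.
move=> S; have fd := lowf_differentiable S.
have hd := lowh_differentiable S; have gd := lowg_differentiable S.
have muc : continuous (dotp mu : 'rV[R]_r -> R) by exact: linear_row_continuous.
have xic : continuous (dotp xi : 'rV[R]_s -> R) by exact: linear_row_continuous.
have Hh := is_diff_lin_comp muc hd; have Hg := is_diff_lin_comp xic gd.
have H := is_diffD (is_diffD (differentiableP fd) Hh) Hg.
apply: is_diff_eq H _; apply/funext => d.
rewrite /lagr_grad !dotpDl dotp_grad// -!dotp_mul !mul_jacobian.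
by [].
Qed.

Lemma grad_lagrangian x y mu xi : smooth_lower P x y ->
  grad (fun z => lagrangian P x z mu xi) y = lagr_grad x y mu xi.
Proof. by move=> S; exact/is_diff_grad/lagrangian_is_diff. Qed.

Lemma lagr_gradW_C1 x y mu xi : smooth_lower P x y -> C1_around lagr_gradW (x, pack y mu xi).
Proof.
move=> [_ [cdf cdg cdh]].
have e : xy_part (x, pack y mu xi) = (x, y) by exact: xy_part_pack.
rewrite -e in cdf cdg cdh.
have xyPc := @xy_part_continuous R n m r s.
have Cf := C1_comp_lin xyPc cdf.
have Cg := C1_comp_lin xyPc cdg.
have Ch := C1_comp_lin xyPc cdh.
have Cmu := C1_lin (x, pack y mu xi) (@mu_part_continuous R n m r s).
have Cxi := C1_lin (x, pack y mu xi) (@xi_part_continuous R n m r s).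
exact: (C1_add (C1_add Cf (C1_mul_trmx Cmu Ch)) (C1_mul_trmx Cxi Cg)).
Qed.

(** For fixed x, mu and xi, the gradient of the Lagrangian agrees near [y]
    with the restriction of [lagr_gradW] to an affine subspace. *)
Lemma grad_lagrangian_is_diff x y mu xi : smooth_lower P x y ->
  is_diff y (grad (fun z => lagrangian P x z mu xi))
    (fun d => dif lagr_gradW (x, pack y mu xi) (yshift d)).
Proof.
move=> S.
have statE z : lagr_gradW ((x, pack 0 mu xi) + yshift z) = lagr_grad x z mu xi.
  rewrite (_ : _ + _ = (x, pack z mu xi)).
    by rewrite /lagr_gradW y_part_pack mu_part_pack xi_part_pack.
  rewrite -[LHS]/(x + 0, pack 0 mu xi + pack z 0 0) addr0 /pack.
  by rewrite !add_row_mx !addr0 add0r.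
have e : (x, pack 0 mu xi) + yshift y = (x, pack y mu xi).
  rewrite -[LHS]/(x + 0, pack 0 mu xi + pack y 0 0) addr0 /pack.
  by rewrite !add_row_mx !addr0 add0r.
have sd : differentiable lagr_gradW ((x, pack 0 mu xi) + yshift y).
  by rewrite e; exact/C1_differentiable/lagr_gradW_C1.
have H := is_diff_affine (@yshift_continuous R n m r s) sd.
have near_stat : \forall z \near y,
    lagr_gradW ((x, pack 0 mu xi) + yshift z) =
    grad (fun z => lagrangian P x z mu xi) z.
  have Sz : \forall z \near y, smooth_lower P x z.
    have [e' e'0 He'] := smooth_near S.
    apply/nbhs_ballP; exists e' => //= z; rewrite -ball_normE /= distrC => ze.
    by apply: He' => //; rewrite subrr normr0.
  by apply: filterS Sz => z Sz; rewrite statE grad_lagrangian.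
by rewrite -e; exact: (is_diff_near_eq near_stat H).
Qed.

Lemma mul_hess_lagrangian x y mu xi d : smooth_lower P x y ->
  d *m hess (fun z => lagrangian P x z mu xi) y =
  dif lagr_gradW (x, pack y mu xi) (yshift d).
Proof.
move=> S; rewrite /hess mul_jacobian.
exact: (is_diff_dif _ (grad_lagrangian_is_diff mu xi S)).
Qed.

(** [lagr_gradW] is affine in the multipliers, so in these directions its
    differential is its linear part; what remains is the Hessian. *)
Lemma dif_lagr_gradW x y mu xi a b c : smooth_lower P x y ->
  dif lagr_gradW (x, pack y mu xi) (0, pack a b c) =
  a *m hess (fun z => lagrangian P x z mu xi) y +
  b *m ('J (lowh P x) y)^T + c *m ('J (lowg P x) y)^T.
Proof.
move=> S; rewrite mul_hess_lagrangian//.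
have -> : ((0, pack a b c) : W) = yshift a + (0, pack 0 b c).
  rewrite -[RHS]/(0 + 0, pack a 0 0 + pack 0 b c) addr0 /pack.
  by rewrite !add_row_mx !addr0 !add0r.
rewrite difD -addrA; congr (_ + _).
pose A : 'M[R]_(r + s, m) := col_mx ('J (lowh P x) y)^T ('J (lowg P x) y)^T.
pose L (bc : 'rV[R]_(r + s)) : W := inr0 'rV[R]_n (row_mx 0 bc).
have Ll : linear L.
  move=> t v w; rewrite /L -linearP; congr (inr0 _ _).
  by rewrite scale_row_mx add_row_mx scaler0 addr0.
pose L' : {linear 'rV[R]_(r + s) -> W} :=
  HB.pack L (GRing.isLinear.Build _ _ _ _ _ Ll).
have Lc : continuous L' by exact: linear_row_continuous.
pose w0 : W := (x, pack y mu xi).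
have e bc : w0 + L' bc = (x, row_mx y (row_mx mu xi + bc)).
  rewrite -[LHS]/(x + 0, row_mx y (row_mx mu xi) + row_mx 0 bc).
  by rewrite addr0 add_row_mx addr0.
have e0 : w0 + L' 0 = w0 by rewrite (linear0 L') addr0.
have sd : differentiable lagr_gradW (w0 + L' 0).
  by rewrite e0; exact/C1_differentiable/lagr_gradW_C1.
have H := is_diff_affine Lc sd.
have statA bc : lagr_gradW (w0 + L' bc) = lagr_gradW w0 + bc *m A.
  rewrite e /lagr_gradW /lagr_grad y_part_pack mu_part_pack xi_part_pack.
  have -> : (x, row_mx y (row_mx mu xi + bc)) =
      (x, pack y (mu + lsubmx bc) (xi + rsubmx bc)).
    by rewrite /pack -add_row_mx hsubmxK.
  rewrite y_part_pack mu_part_pack xi_part_pack /= /A -[bc in RHS]hsubmxK mul_row_col !mulmxDl.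
  by rewrite addrACA -!addrA; congr (_ + _); rewrite addrCA.
pose Ar : {linear 'rV[R]_(r + s) -> 'rV[R]_m} := mulmxr A.
have Arc : continuous Ar by exact: linear_row_continuous.
have H' : is_diff (0 : 'rV[R]_(r + s)) (fun bc => lagr_gradW (w0 + L' bc))
    (0 + (Ar : _ -> _)).
  rewrite (_ : (fun _ => _) = cst (lagr_gradW w0) + (Ar : _ -> _)).
    exact: (is_diffD (is_diff_cst _ _) (is_diff_lin _ Arc)).
  by apply/funext => bc; rewrite statA.
have E1 := is_diff_dif (row_mx b c) H; have E2 := is_diff_dif (row_mx b c) H'.
have := etrans (esym E1) E2.
rewrite add0r e0 => E; apply: (etrans E); exact: mul_row_col.
Qed.

End System.

(** * The KKT system as a map of class C1 *)

(** Coefficients are indexed by the members of [s] instead of by positions. *)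
Lemma free_mapP (K : fieldType) (vT : vectType K) (T : eqType) (s : seq T)
    (f : T -> vT) : uniq s ->
  free (map f s) <->
  (forall k : T -> K, \sum_(t <- s) k t *: f t = 0 -> forall t, t \in s -> k t = 0).
Proof.
move=> us; set X := in_tuple (map f s).
have sX : size (map f s) = size s by rewrite size_map.
split.
  move=> fs k ks t ts; have /freeP H : free X by [].
  have it : (index t s < size (map f s))%N by rewrite sX index_mem.
  have -> : k t = k (nth t s (Ordinal it)) by rewrite /= nth_index.
  apply: (H (fun i => k (nth t s i))).
  rewrite -[RHS]ks (big_nth t) big_mkord -sX; apply: eq_bigr => i _.
  by rewrite (nth_map t)// -sX.
move=> H; apply/(freeP (X := X)) => k ks i.
have t0 : T by case: (s) sX (i) => [/= _ []|].
pose k' t := oapp k 0 (insub (index t s)).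
have k'E (j : 'I_(size (map f s))) : k' (nth t0 s j) = k j.
  by rewrite /k' index_uniq -?sX// valK.
rewrite -k'E; apply: H; last by rewrite mem_nth// -sX.
rewrite (big_nth t0) big_mkord -sX -[RHS]ks; apply: eq_bigr => j _.
by rewrite k'E (nth_map t0)// -sX.
Qed.

Section KKTMap.
Context {R : realType} (n m p q r s : nat) (P : bilevel R n m p q r s).

Local Notation U := 'rV[R]_(m + (r + s)).
Local Notation W := ('rV[R]_n * U)%type.
Local Notation y_part := (@y_part R n m r s).
Local Notation xi_part := (@xi_part R n m r s).
Local Notation xy_part := (@xy_part R n m r s).

(** The active gradients are rows of the transposed Jacobians: a vanishing
    combination of them is a pair of multipliers, the second one supported on
    the active set. *)
Lemma LICQ_mulmx x y : smooth_lower P x y ->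
  LICQ P x y <->
  (forall (b : 'rV[R]_r) (c : 'rV[R]_s), (forall i, i \notin active P x y -> c 0 i = 0) ->
     b *m ('J (lowh P x) y)^T + c *m ('J (lowg P x) y)^T = 0 -> b = 0 /\ c = 0).
Proof.
move=> S; have hd := lowh_differentiable S; have gd := lowg_differentiable S.
set Jh := 'J _ _; set Jg := 'J _ _; set I := active P x y.
pose f (t : 'I_r + 'I_s) : 'rV[R]_m := match t with
  | inl j => grad (fun z => lowh P x z 0 j) y
  | inr i => grad (fun z => lowg P x z 0 i) y end.
pose sq : seq ('I_r + 'I_s) := map inl (enum 'I_r) ++ map inr (enum I).
have usq : uniq sq.
  rewrite cat_uniq; apply/and3P; split.
  - by rewrite map_inj_uniq ?enum_uniq// => ? ? [].
  - by apply/hasPn => _ /mapP[i _ ->]; apply/mapP => -[].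
  - by rewrite map_inj_uniq ?enum_uniq// => ? ? [].
have fsq : LICQ P x y <-> free (map f sq) by rewrite map_cat -(map_comp f inl) -(map_comp f inr); split.
have sumE (k : 'I_r + 'I_s -> R) :
    \sum_(t <- sq) k t *: f t = (\row_j k (inl j)) *m Jh^T +
      (\row_i (if i \in I then k (inr i) else 0)) *m Jg^T.
  rewrite big_cat (big_map (@inl 'I_r 'I_s)) (big_map (@inr 'I_r 'I_s)).
  congr (_ + _).
    rewrite mulmx_sum_row big_enum /=; apply: eq_bigr => j _.
    by rewrite mxE grad_coord// tr_col.
  rewrite mulmx_sum_row big_enum /= big_mkcond; apply: eq_bigr => i _.
  by rewrite mxE grad_coord// tr_col; case: ifP; rewrite ?scale0r.
split.
  move=> /fsq/(free_mapP _ usq) H b c cI bc.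
  pose k (t : 'I_r + 'I_s) := match t with inl j => b 0 j | inr i => c 0 i end.
  have bE : \row_j k (inl j) = b by apply/rowP => j; rewrite mxE.
  have cE : \row_i (if i \in I then k (inr i) else 0) = c.
    by apply/rowP => i; rewrite mxE /=; case: ifPn => // /cI ->.
  have ks : \sum_(t <- sq) k t *: f t = 0 by rewrite sumE bE cE.
  split; apply/rowP => j; rewrite mxE.
    by apply: (H _ ks (inl j)); rewrite mem_cat map_f// mem_enum.
  have [jI|/cI//] := boolP (j \in I).
  by apply: (H _ ks (inr j)); rewrite mem_cat orbC map_f// mem_enum.
move=> H; apply/fsq/(free_mapP _ usq) => k; rewrite sumE => /H[].
  by move=> i /negbTE iI; rewrite mxE iI.
move=> /rowP b0 /rowP c0 t; rewrite mem_cat => /orP[/mapP[j _ ->]|/mapP[i]].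
  by have := b0 j; rewrite !mxE.
by rewrite mem_enum => iI ->; have := c0 i; rewrite !mxE iI.
Qed.

(** Complementarity is written as xi_i g_i = 0, which keeps the system square
    and of class C1. The signs of xi and g are lost, but near a strictly
    complementary point they are determined (see [active_stable]). *)
Definition kkt_map (w : W) : U :=
  pack (lagr_gradW P w) (lowh P w.1 (y_part w))
    (\row_i (xi_part w 0 i * lowg P w.1 (y_part w) 0 i)).

Lemma lowh_C1 x y mu xi : smooth_lower P x y ->
  C1_around (fun w : W => lowh P w.1 (y_part w)) (x, pack y mu xi).
Proof.
move=> [[_ _ ch] _].
have e : xy_part (x, pack y mu xi) = (x, y) by exact: xy_part_pack.
by rewrite -e in ch; exact: (C1_comp_lin (@xy_part_continuous R n m r s) ch).
Qed.

Lemma lowg_C1 x y mu xi : smooth_lower P x y ->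
  C1_around (fun w : W => lowg P w.1 (y_part w)) (x, pack y mu xi).
Proof.
move=> [[_ cg _] _].
have e : xy_part (x, pack y mu xi) = (x, y) by exact: xy_part_pack.
by rewrite -e in cg; exact: (C1_comp_lin (@xy_part_continuous R n m r s) cg).
Qed.

Lemma lowf_C1 x y mu xi : smooth_lower P x y ->
  C1_around (fun w : W => lowf P w.1 (y_part w)) (x, pack y mu xi).
Proof.
move=> [[cf _ _] _].
have e : xy_part (x, pack y mu xi) = (x, y) by exact: xy_part_pack.
by rewrite -e in cf; exact: (C1_comp_lin (@xy_part_continuous R n m r s) cf).
Qed.

Lemma slack_C1 x y mu xi i : smooth_lower P x y ->
  C1_around (fun w : W => xi_part w 0 i * lowg P w.1 (y_part w) 0 i) (x, pack y mu xi).
Proof.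
move=> S; have Cxi := C1_lin (x, pack y mu xi) (@xi_part_continuous R n m r s).
exact: (C1_mul (C1_coord 0 i Cxi) (C1_coord 0 i (lowg_C1 mu xi S))).
Qed.

Lemma kkt_map_C1 x y mu xi : smooth_lower P x y ->
  C1_around kkt_map (x, pack y mu xi).
Proof.
move=> S; apply: C1_row_mx; first exact: lagr_gradW_C1.
apply: C1_row_mx; first exact: lowh_C1.
by apply: C1_row => i; exact: slack_C1.
Qed.

Lemma dif_lowh x y mu xi a b c : smooth_lower P x y ->
  dif (fun w : W => lowh P w.1 (y_part w)) (x, pack y mu xi) (0, pack a b c) =
  a *m 'J (lowh P x) y.
Proof.
move=> [[_ _ /C1_differentiable dh] _].
by rewrite mul_jacobian; exact: (dif_pack mu xi a b c dh).
Qed.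

Lemma dif_lowg x y mu xi a b c : smooth_lower P x y ->
  dif (fun w : W => lowg P w.1 (y_part w)) (x, pack y mu xi) (0, pack a b c) =
  a *m 'J (lowg P x) y.
Proof.
move=> [[_ /C1_differentiable dg _] _].
by rewrite mul_jacobian; exact: (dif_pack mu xi a b c dg).
Qed.

Lemma dif_lowf x y mu xi a b c : smooth_lower P x y ->
  dif (fun w : W => lowf P w.1 (y_part w)) (x, pack y mu xi) (0, pack a b c) =
  dotp (grad (lowf P x) y) a.
Proof.
move=> S; have fd := lowf_differentiable S.
have [[/C1_differentiable df _ _] _] := S.
by rewrite dotp_grad//; exact: (dif_pack mu xi a b c df).
Qed.

End KKTMap.

Section KKTSystem.
Context {R : realType} (n m p q r s : nat) (P : bilevel R n m p q r s).

Local Notation U := 'rV[R]_(m + (r + s)).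
Local Notation W := ('rV[R]_n * U)%type.
Local Notation y_part := (@y_part R n m r s).
Local Notation xi_part := (@xi_part R n m r s).

Lemma dif_xi_part (w v : W) : dif xi_part w v = xi_part v.
Proof. exact: (is_diff_dif _ (is_diff_lin w (@xi_part_continuous R n m r s))). Qed.

Lemma dif_slack x y mu xi a b c i : smooth_lower P x y ->
  dif (fun w : W => xi_part w 0 i * lowg P w.1 (y_part w) 0 i)
    (x, pack y mu xi) (0, pack a b c) =
  xi 0 i * (a *m 'J (lowg P x) y) 0 i + c 0 i * lowg P x y 0 i.
Proof.
move=> S; rewrite dif_coord_mul.
- by rewrite dif_xi_part dif_lowg// !xi_part_pack y_part_pack.
- exact: (linear_differentiable _ (@xi_part_continuous R n m r s)).
- exact: (C1_differentiable (lowg_C1 mu xi S)).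
Qed.

Lemma dif_kkt_map x y mu xi a b c : smooth_lower P x y ->
  dif (kkt_map P) (x, pack y mu xi) (0, pack a b c) =
  pack (a *m hess (fun z => lagrangian P x z mu xi) y +
        b *m ('J (lowh P x) y)^T + c *m ('J (lowg P x) y)^T)
    (a *m 'J (lowh P x) y)
    (\row_i (xi 0 i * (a *m 'J (lowg P x) y) 0 i + c 0 i * lowg P x y 0 i)).
Proof.
move=> S; have Kd := C1_differentiable (kkt_map_C1 mu xi S).
set D := dif _ _ _.
have block k (L : {linear U -> 'rV[R]_k}) :
    L D = dif (L \o kkt_map P) (x, pack y mu xi) (0, pack a b c).
  by rewrite dif_lin_comp//; exact: linear_row_continuous.
rewrite -[D]hsubmxK -[rsubmx D]hsubmxK -/(pack _ _ _).
rewrite -dif_lagr_gradW// -(dif_lowh mu xi a b c S).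
congr pack.
- rewrite (block _ lsubmx).
  have -> : lsubmx \o kkt_map P = lagr_gradW P by apply/funext => w; exact: row_mxKl.
  by [].
- apply: (etrans (block _ (lsubmx \o rsubmx))).
  have -> : (lsubmx \o rsubmx) \o kkt_map P = fun w => lowh P w.1 (y_part w).
    by apply/funext => w; rewrite /= /kkt_map row_mxKr row_mxKl.
  by [].
- apply/rowP => i; rewrite [RHS]mxE; apply: (etrans _ (dif_slack mu xi a b c i S)).
  have E := block _ (rsubmx \o rsubmx).
  apply: (etrans (congr1 (fun u : 'rV[R]_s => u 0 i) E)).
  have -> : (rsubmx \o rsubmx) \o kkt_map P =
      fun w => \row_i (xi_part w 0 i * lowg P w.1 (y_part w) 0 i).
    by apply/funext => w; rewrite /= /kkt_map !row_mxKr.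
  rewrite -dif_coord; last first.
    by apply: C1_differentiable; apply: C1_row => j; exact: slack_C1.
  by congr (dif _ _ _); apply/funext => w; rewrite mxE.
Qed.

Lemma KKT_complementary x y mu xi i : KKT P x y mu xi ->
  xi 0 i * lowg P x y 0 i = 0.
Proof.
move=> [_ _ xi0 g0 c0].
have H : \sum_i - (xi 0 i * lowg P x y 0 i) = 0.
  by rewrite sumrN -/(dotp _ _) c0 oppr0.
apply/eqP; rewrite -oppr_eq0; apply/eqP.
apply: (psumr_eq0P _ H) => // j _.
by rewrite oppr_ge0 mulr_ge0_le0.
Qed.

Lemma kkt_map_eq0 x y mu xi : smooth_lower P x y ->
  kkt_map P (x, pack y mu xi) = 0 <->
  [/\ grad (fun z => lagrangian P x z mu xi) y = 0, lowh P x y = 0 &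
      forall i, xi 0 i * lowg P x y 0 i = 0].
Proof.
move=> S; rewrite grad_lagrangian// /kkt_map /lagr_gradW y_part_pack mu_part_pack xi_part_pack.
split.
  rewrite /pack => /eqP; rewrite !row_mx_eq0 => /and3P[/eqP-> /eqP-> /eqP/rowP g0].
  by split => // i; have := g0 i; rewrite !mxE.
move=> [-> -> g0]; rewrite /pack.
have -> : \row_i (xi 0 i * lowg P x y 0 i) = 0 by apply/rowP => i; rewrite !mxE.
by rewrite !row_mx0.
Qed.

End KKTSystem.

(** * Nonsingularity under the Jacobian uniqueness conditions *)

Section JacobianUniqueness.
Context {R : realType} (n m p q r s : nat) (P : bilevel R n m p q r s).

Local Notation H x y mu xi := (hess (fun z => lagrangian P x z mu xi) y).

Lemma KKT_grad_dotp x y mu xi d : smooth_lower P x y -> KKT P x y mu xi ->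
  dotp (grad (lowf P x) y) d + dotp mu (d *m 'J (lowh P x) y) +
  dotp xi (d *m 'J (lowg P x) y) = 0.
Proof.
move=> S [gL _ _ _ _]; rewrite !dotp_mul -!dotpDl -/(lagr_grad P x y mu xi).
by rewrite -grad_lagrangian// gL /dotp big1// => i _; rewrite mxE mul0r.
Qed.

(** Let (a, b, c) be in the kernel. By strict complementarity the linearised
    equations xi_i g_i = 0 make [a] tangent to the active constraints and put the
    support of [c] in the active set. Hence [a] is critical, and pairing the first
    equation with [a] removes the multiplier terms, so that second-order
    sufficiency gives a = 0. What is left of the first equation is the relation
    that LICQ excludes. *)
Lemma jacobian_uniqueness_injective x y mu xi v : smooth_lower P x y ->
  jacobian_uniqueness P x y mu xi ->
  dif (kkt_map P) (x, pack y mu xi) (0, v) = 0 -> v = 0.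
Proof.
move=> S [K L C Q].
have [a [b [c ->]]] : exists a b c, v = pack a b c.
  exists (lsubmx v), (lsubmx (rsubmx v)), (rsubmx (rsubmx v)).
  by rewrite /pack !hsubmxK.
rewrite dif_kkt_map// /pack => /eqP.
rewrite !row_mx_eq0 => /and3P[/eqP E1 /eqP E2 /eqP/rowP E3].
have [_ _ xi0 g0 _] := K.
have act i : i \in active P x y -> (a *m 'J (lowg P x) y) 0 i = 0.
  rewrite inE => /eqP gi; have := E3 i; have := C i.
  rewrite !mxE gi subr0 mulr0 addr0 => xi_gt0 /eqP.
  by rewrite mulf_eq0 gt_eqF//= => /eqP.
have inact i : i \notin active P x y -> xi 0 i = 0 /\ c 0 i = 0.
  rewrite inE => gi; have := KKT_complementary i K => /eqP.
  rewrite mulf_eq0 (negbTE gi) orbF => /eqP xii; split => //.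
  have := E3 i; rewrite !mxE xii mul0r add0r => /eqP.
  by rewrite mulf_eq0 (negbTE gi) orbF => /eqP.
have a0 : a = 0.
  apply/eqP/negPn/negP => an0.
  have xi_a : dotp xi (a *m 'J (lowg P x) y) = 0.
    apply: big1 => i _; have [/act ->|/inact[-> _]] := boolP (i \in active P x y).
      by rewrite mulr0.
    by rewrite mul0r.
  have c_a : dotp c (a *m 'J (lowg P x) y) = 0.
    apply: big1 => i _; have [/act ->|/inact[_ ->]] := boolP (i \in active P x y).
      by rewrite mulr0.
    by rewrite mul0r.
  have cone : critical_cone P x y a.
    split => //.
      move=> i /act ai; rewrite dotp_grad_coord ?ai//.
      exact: lowg_differentiable.
    have := KKT_grad_dotp a S K; rewrite E2 xi_a linear0 !addr0 => ->.
    by [].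
  have := Q _ cone an0.
  have -> : a *m H x y mu xi =
      - (b *m ('J (lowh P x) y)^T + c *m ('J (lowg P x) y)^T).
    by apply/eqP; rewrite -addr_eq0 addrA E1.
  rewrite dotpC linearN /= dotpC dotpDl -!dotp_mul c_a E2 linear0 addr0 oppr0.
  by rewrite ltxx.
rewrite a0 !mul0mx add0r in E1.
have [b0 c0] := (LICQ_mulmx S).1 L b c (fun i ia => (inact i ia).2) E1.
by rewrite a0 b0 c0 !row_mx0.
Qed.

End JacobianUniqueness.

(** * Stability near the reference point *)

Section ContinuousSign.
Context {R : realType} (V : normedModType R).

Lemma continuous_pos_ball (phi : V -> R) z :
  {for z, continuous phi} -> 0 < phi z ->
  exists2 e : R, 0 < e & forall w, `|w - z| < e -> 0 < phi w.
Proof.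
move=> phic phiz; have /cvgrPdist_lt/(_ _ phiz)/nbhs_ballP[e /= e0 He] := phic.
exists e => // w we; have : `|phi z - phi w| < phi z.
  by apply: He; rewrite -ball_normE /= distrC.
by rewrite ltr_norml => /andP[]; lra.
Qed.

Lemma ball_forall (I : finType) (Q : I -> V -> Prop) z :
  (forall i, exists2 e : R, 0 < e & forall w, `|w - z| < e -> Q i w) ->
  exists2 e : R, 0 < e & forall w, `|w - z| < e -> forall i, Q i w.
Proof.
move=> H.
have near_i i : \forall w \near z, Q i w.
  by have [e e0 He] := H i; exact: (ball_near e0).
exact: (near_ball (filter_forall (nbhs_filter z) near_i)).
Qed.

End ContinuousSign.

Section NearReference.
Context {R : realType} (n m p q r s : nat) (P : bilevel R n m p q r s).
Variables (xs : 'rV[R]_n) (ys : 'rV[R]_m) (mus : 'rV[R]_r) (xis : 'rV[R]_s).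
Hypothesis S : smooth_lower P xs ys.
Hypothesis JU : jacobian_uniqueness P xs ys mus xis.

Local Notation U := 'rV[R]_(m + (r + s)).
Local Notation W := ('rV[R]_n * U)%type.
Local Notation y_part := (@y_part R n m r s).
Local Notation xi_part := (@xi_part R n m r s).
Local Notation yshift := (@yshift R n m r s).
Local Notation H x y mu xi := (hess (fun z => lagrangian P x z mu xi) y).

Definition near_ref (e : R) (x : 'rV[R]_n) (y : 'rV[R]_m) (mu : 'rV[R]_r)
    (xi : 'rV[R]_s) : Prop :=
  [/\ `|x - xs| < e, `|y - ys| < e, `|mu - mus| < e & `|xi - xis| < e].

Lemma near_ref_le (e e' : R) x y mu xi : e <= e' ->
  near_ref e x y mu xi -> near_ref e' x y mu xi.
Proof. by move=> ee' [? ? ? ?]; split; exact: lt_le_trans ee'. Qed.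

Lemma near_ref_pack e x y mu xi : near_ref e x y mu xi ->
  `|((x, pack y mu xi) : W) - (xs, pack ys mus xis)| < e.
Proof. by move=> [? ? ? ?]; exact: pack_box. Qed.

(** Every constraint is strictly active (xi_i > 0) or strictly inactive
    (g_i < 0) at the reference point, and both conditions are open. *)
Lemma active_stable : exists2 e : R, 0 < e & forall x y mu xi,
  near_ref e x y mu xi -> forall i,
    (i \in active P xs ys -> 0 < xi 0 i) /\
    (i \notin active P xs ys -> lowg P x y 0 i < 0).
Proof.
have [K _ C _] := JU; have [_ _ xi0 g0 _] := K.
pose w0 : W := (xs, pack ys mus xis).
have [e e0 He] : exists2 e : R, 0 < e & forall w : W, `|w - w0| < e -> forall i,
    (i \in active P xs ys -> 0 < xi_part w 0 i) /\
    (i \notin active P xs ys -> lowg P w.1 (y_part w) 0 i < 0).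
  apply: ball_forall => i; have [iA|iA] := boolP (i \in active P xs ys).
    have xi_c : {for w0, continuous (fun w : W => xi_part w 0 i)}.
      apply/C1_continuous/(C1_coord 0 i).
      exact: (C1_lin _ (@xi_part_continuous R n m r s)).
    have xi_pos : 0 < xi_part w0 0 i.
      rewrite xi_part_pack; have := C i.
      by move: iA; rewrite inE => /eqP->; rewrite subr0.
    have [e e0 He] := continuous_pos_ball xi_c xi_pos.
    by exists e => // w we; split => // _; exact: He.
  have g_c : {for w0, continuous (fun w : W => - lowg P w.1 (y_part w) 0 i)}.
    apply: continuousN; apply/C1_continuous/(C1_coord 0 i).
    exact: lowg_C1.
  have g_neg : 0 < - lowg P w0.1 (y_part w0) 0 i.
    rewrite y_part_pack /= oppr_gt0 lt_neqAle g0 andbT.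
    by move: iA; rewrite inE.
  have [e e0 He] := continuous_pos_ball g_c g_neg.
  by exists e => // w we; split => // _; rewrite -oppr_gt0; exact: He.
exists e => // x y mu xi xe i.
by have := He _ (near_ref_pack xe) i; rewrite xi_part_pack y_part_pack.
Qed.

(** Four certificates that [u] is not a critical direction of nonpositive
    curvature. The certificate may depend on [u], but has to hold on all of [Z];
    in the first one [sigma] selects the sign. *)
Definition good_direction (Z : 'rV[R]_n -> 'rV[R]_m -> 'rV[R]_r -> 'rV[R]_s -> Prop)
    (u : 'rV[R]_m) : Prop :=
  [\/ exists j (sigma : R), forall x y mu xi, Z x y mu xi ->
        0 < sigma * (u *m 'J (lowh P x) y) 0 j,
      exists2 i, i \in active P xs ys & forall x y mu xi, Z x y mu xi ->
        0 < (u *m 'J (lowg P x) y) 0 i,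
      forall x y mu xi, Z x y mu xi -> 0 < dotp (grad (lowf P x) y) u |
      forall x y mu xi, Z x y mu xi -> 0 < dotp (u *m H x y mu xi) u].

(** The quantities of [good_direction] as functions of a point of the product
    space and a direction, the form in which [uniform_direction] takes them. *)
Definition h_form (j : 'I_r) (sigma : R) (w : W) (u : 'rV[R]_m) : R :=
  sigma * dif (fun w : W => lowh P w.1 (y_part w) 0 j) w (yshift u).
Definition g_form (i : 'I_s) (w : W) (u : 'rV[R]_m) : R :=
  dif (fun w : W => lowg P w.1 (y_part w) 0 i) w (yshift u).
Definition f_form (w : W) (u : 'rV[R]_m) : R :=
  dif (fun w : W => lowf P w.1 (y_part w)) w (yshift u).
Definition L_form (w : W) (u : 'rV[R]_m) : R :=
  \sum_j dif (fun w : W => lagr_gradW P w 0 j) w (yshift u) * u 0 j.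

Lemma h_formE j sigma x y mu xi u : smooth_lower P x y ->
  h_form j sigma (x, pack y mu xi) u = sigma * (u *m 'J (lowh P x) y) 0 j.
Proof.
move=> Sx; rewrite /h_form dif_coord; last exact: C1_differentiable (lowh_C1 mu xi Sx).
by rewrite dif_lowh.
Qed.

Lemma g_formE i x y mu xi u : smooth_lower P x y ->
  g_form i (x, pack y mu xi) u = (u *m 'J (lowg P x) y) 0 i.
Proof.
move=> Sx; rewrite /g_form dif_coord; last exact: C1_differentiable (lowg_C1 mu xi Sx).
by rewrite dif_lowg.
Qed.

Lemma f_formE x y mu xi u : smooth_lower P x y ->
  f_form (x, pack y mu xi) u = dotp (grad (lowf P x) y) u.
Proof. by move=> Sx; rewrite /f_form dif_lowf. Qed.

Lemma L_formE x y mu xi u : smooth_lower P x y ->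
  L_form (x, pack y mu xi) u = dotp (u *m H x y mu xi) u.
Proof.
move=> Sx; rewrite mul_hess_lagrangian//; apply: eq_bigr => j _.
by rewrite dif_coord//; exact: (C1_differentiable (lagr_gradW_C1 mu xi Sx)).
Qed.

(** At the reference point, a direction outside the critical cone has one of
    the first three certificates, and a nonzero one inside it has the fourth by
    second-order sufficiency; compactness makes the choice uniform. *)
Lemma uniform_good_direction : exists2 e : R, 0 < e &
  forall u, u != 0 -> good_direction (near_ref e) u.
Proof.
have [K L C Q] := JU; pose w0 : W := (xs, pack ys mus xis).
have [e1 e10 S1] := smooth_near S.
pose A : set (W -> 'rV[R]_m -> R) := [set a |
  [\/ exists j sigma, a = h_form j sigma,
      exists2 i, i \in active P xs ys & a = g_form i,
      a = f_form | a = L_form]].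
have yshift_lin : forall (c : R) u, yshift (c *: u) = c *: yshift u.
  by move=> c u; exact: linearZ.
have [e e0 He] : exists2 e : R, 0 < e & forall u, u != 0 ->
    exists2 a, A a & forall w, `|w - w0| < e -> 0 < a w u.
  apply: uniform_direction.
  - move=> a u Aa; apply: continuous_pos_box.
    case: Aa => [[j [sg ->]]|[i _ ->]|->|->].
    + apply: cvgM; first exact: cvg_cst.
      by apply: dif_along_continuous; exact/C1_coord/lowh_C1.
    + by apply: dif_along_continuous; exact/C1_coord/lowg_C1.
    + by apply: dif_along_continuous; exact/lowf_C1.
    + by apply: dif_form_continuous; exact: lagr_gradW_C1.
  - move=> a w u c Aa c0; case: Aa => [[j [sg ->]]|[i _ ->]|->|->].
    + by rewrite /h_form yshift_lin difZ mulrCA pmulr_rgt0.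
    + by rewrite /g_form yshift_lin difZ pmulr_rgt0.
    + by rewrite /f_form yshift_lin difZ pmulr_rgt0.
    + rewrite (_ : L_form w (c *: u) = (c * c) * L_form w u).
        by rewrite pmulr_rgt0// mulr_gt0.
      rewrite /L_form mulr_sumr; apply: eq_bigr => j _.
      by rewrite yshift_lin difZ mxE -[_ *: _]/(_ * _); ring.
  - move=> u u0; have [hu|hu] := eqVneq (u *m 'J (lowh P xs) ys) 0; last first.
      have [j hj] : exists j, (u *m 'J (lowh P xs) ys) 0 j != 0.
        apply: contrapT => /forallNP hj; move/eqP: hu; apply; apply/rowP => j.
        by rewrite [RHS]mxE; apply/eqP/negPn/negP; exact: hj.
      (* with the value itself as sigma the product is a square *)
      exists (h_form j ((u *m 'J (lowh P xs) ys) 0 j)).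
        by constructor 1; exists j, ((u *m 'J (lowh P xs) ys) 0 j).
      by rewrite h_formE// -expr2 exprn_even_gt0.
    have [[i [iA gi]]|gu] := pselect (exists i, i \in active P xs ys /\
        0 < (u *m 'J (lowg P xs) ys) 0 i).
      by exists (g_form i); [constructor 2; exists i|rewrite g_formE].
    have [fu|fu] := ltP 0 (dotp (grad (lowf P xs) ys) u).
      by exists f_form; [constructor 3|rewrite f_formE].
    exists L_form; first by constructor 4.
    rewrite L_formE//; apply: Q => //; split => //= i iA.
    rewrite dotp_grad_coord; last exact: lowg_differentiable.
    by rewrite leNgt; apply/negP => gi; apply: gu; exists i.
exists (Num.min e e1) => [|u u0]; first by rewrite lt_min e0.
have sub x y mu xi : near_ref (Num.min e e1) x y mu xi -> smooth_lower P x y /\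
    `|((x, pack y mu xi) : W) - w0| < e.
  move=> xe; split.
    have [xe1 ye1 _ _] : near_ref e1 x y mu xi.
      by apply: near_ref_le xe; rewrite ge_min lexx orbT.
    exact: S1.
  by apply: near_ref_pack; apply: near_ref_le xe; rewrite ge_min lexx.
have [a [[j [sg ->]]|[i iA ->]|->|->] Ha] := He u u0.
- constructor 1; exists j, sg => x y mu xi /sub[Sx we].
  by rewrite -(h_formE _ _ mu xi)//; exact: Ha.
- constructor 2; exists i => // x y mu xi /sub[Sx we].
  by rewrite -(g_formE _ mu xi)//; exact: Ha.
- constructor 3 => x y mu xi /sub[Sx we].
  by rewrite -(f_formE mu xi)//; exact: Ha.
- constructor 4 => x y mu xi /sub[Sx we].
  by rewrite -L_formE//; exact: Ha.
Qed.

End NearReference.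

Section NearReference2.
Context {R : realType} (n m p q r s : nat) (P : bilevel R n m p q r s).
Variables (xs : 'rV[R]_n) (ys : 'rV[R]_m) (mus : 'rV[R]_r) (xis : 'rV[R]_s).
Hypothesis S : smooth_lower P xs ys.
Hypothesis JU : jacobian_uniqueness P xs ys mus xis.

Local Notation near_ref := (near_ref xs ys mus xis).

Lemma stable_box : exists2 e : R, 0 < e &
  [/\ forall x y, `|x - xs| < e -> `|y - ys| < e -> smooth_lower P x y,
      forall x y mu xi, near_ref e x y mu xi -> forall i,
        (i \in active P xs ys -> 0 < xi 0 i) /\
        (i \notin active P xs ys -> lowg P x y 0 i < 0) &
      forall u, u != 0 -> good_direction P xs ys (near_ref e) u].
Proof.
have [e1 e10 H1] := smooth_near S.
have [e2 e20 H2] := active_stable S JU.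
have [e3 e30 H3] := uniform_good_direction S JU.
pose e := Num.min e1 (Num.min e2 e3).
have e1e : e <= e1 by rewrite ge_min lexx.
have e2e : e <= e2 by rewrite !ge_min lexx /= orbT.
have e3e : e <= e3 by rewrite !ge_min lexx !orbT.
exists e; first by rewrite !lt_min e10 e20.
split.
- by move=> x y xe ye; apply: H1; exact: lt_le_trans e1e.
- by move=> x y mu xi xe; exact: (H2 _ _ _ _ (near_ref_le e2e xe)).
- move=> u /H3[[j [sg Hj]]|[i iA Hi]|Hf|HL].
  + constructor 1; exists j, sg => x y mu xi xe; exact: (Hj _ _ _ _ (near_ref_le e3e xe)).
  + constructor 2; exists i => // x y mu xi xe; exact: (Hi _ _ _ _ (near_ref_le e3e xe)).
  + constructor 3 => x y mu xi xe; exact: (Hf _ _ _ _ (near_ref_le e3e xe)).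
  + constructor 4 => x y mu xi xe; exact: (HL _ _ _ _ (near_ref_le e3e xe)).
Qed.

(** The active set and the signs are those of the reference point, which
    turns a zero of [kkt_map] into a KKT point. Injectivity on the directions
    (0, b, c) is LICQ. A direction with one of the first three certificates is
    not critical, so critical ones have positive curvature. *)
Lemma jacobian_uniqueness_near : exists2 e : R, 0 < e & forall x y mu xi,
  near_ref e x y mu xi -> kkt_map P (x, pack y mu xi) = 0 ->
  (forall v, dif (kkt_map P) (x, pack y mu xi) (0, v) = 0 -> v = 0) ->
  jacobian_uniqueness P x y mu xi.
Proof.
have [e e0 [Hs Ha Hd]] := stable_box; exists e => // x y mu xi xe K0 inj.
have Sx : smooth_lower P x y by case: xe => ? ? _ _; exact: Hs.
have [gL h0 xg] := (kkt_map_eq0 mu xi Sx).1 K0.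
have act i : i \in active P xs ys -> 0 < xi 0 i /\ lowg P x y 0 i = 0.
  move=> iA; have [/(_ iA) xi0 _] := Ha _ _ _ _ xe i; split => //.
  by have := xg i => /eqP; rewrite mulf_eq0 gt_eqF//= => /eqP.
have inact i : i \notin active P xs ys -> xi 0 i = 0 /\ lowg P x y 0 i < 0.
  move=> iA; have [_ /(_ iA) g0] := Ha _ _ _ _ xe i; split => //.
  by have := xg i => /eqP; rewrite mulf_eq0 (lt_eqF g0) orbF => /eqP.
have cases i : i \in active P xs ys \/ i \notin active P xs ys.
  by case: (i \in _); [left|right].
have K : KKT P x y mu xi.
  split => //.
  - by move=> i; have [/act[/ltW]|/inact[->]] := cases i.
  - by move=> i; have [/act[_ ->]|/inact[_ /ltW]] := cases i.
  - by apply: big1 => i _; exact: xg.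
have actE i : i \in active P xs ys -> i \in active P x y.
  by move=> /act[_ gi]; rewrite inE gi.
split => //.
- apply/(LICQ_mulmx Sx) => b c cI bc.
  have : dif (kkt_map P) (x, pack y mu xi) (0, pack 0 b c) = 0.
    rewrite dif_kkt_map// !mul0mx add0r bc.
    rewrite (_ : \row_i _ = 0) ?row_mx0// ?/pack ?row_mx0//.
    apply/rowP => i; rewrite !mxE mulr0 add0r.
    have [iA|/cI->] := boolP (i \in active P x y); last by rewrite mul0r.
    by move: iA; rewrite inE => /eqP->; rewrite mulr0.
  move=> /inj/eqP; rewrite /pack !row_mx_eq0 => /and3P[_ /eqP b0 /eqP c0].
  by [].
- move=> i; have [/act[xi0 ->]|/inact[-> g0]] := cases i; rewrite ?subr0//.
  by rewrite sub0r oppr_gt0.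
- move=> d [dh dg df] d0; have [[j [sg Hj]]|[i iA Hi]|Hf|HL] := Hd d d0.
  + by have := Hj _ _ _ _ xe; rewrite dh mxE mulr0 ltxx.
  + have := dg i (actE i iA); rewrite dotp_grad_coord; last exact: lowg_differentiable.
    by rewrite leNgt (Hi _ _ _ _ xe).
  + by have := Hf _ _ _ _ xe; rewrite ltNge df.
  + exact: HL _ _ _ _ xe.
Qed.

(** The certificate of [u = z - y] holds along the whole segment from [y] to
    [z]. By the mean value theorem the first one moves h away from 0 and the
    second one pushes an active g_i above 0, so that [z] would be infeasible; the
    third one increases f; the fourth one increases the Lagrangian, which equals
    f at [y] and is at most f at [z]. *)
Lemma strict_minimality : exists2 e : R, 0 < e & forall x y mu xi z,
  near_ref e x y mu xi -> `|z - ys| < e -> KKT P x y mu xi -> Y P x z ->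
  z != y -> lowf P x y < lowf P x z.
Proof.
have [e e0 [Hs Ha Hd]] := stable_box; exists e => // x y mu xi z xe ze K [hz gz] zy.
have [xe' ye mue xie] := xe.
pose u := z - y; have u0 : u != 0 by rewrite subr_eq0.
have zE : z = y + u by rewrite addrC subrK.
have [_ hy xi0 gy _] := K.
have seg (t : R) : 0 <= t <= 1 -> near_ref e x (y + t *: u) mu xi.
  by move=> t01; split => //; exact: segment_ball.
have Sseg (t : R) : 0 <= t <= 1 -> smooth_lower P x (y + t *: u).
  by move=> /seg[? ? _ _]; exact: Hs.
have [[j [sg Hj]]|[i iA Hi]|Hf|HL] := Hd u u0.
- have [c c01 E] : exists2 c : R, 0 < c < 1 &
      lowh P x (y + u) 0 j - lowh P x y 0 j =
      'd (fun y' => lowh P x y' 0 j) (y + c *: u) u.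
    apply: (mean_value (f := fun y' => lowh P x y' 0 j)) => t t01.
    exact: (@ex_diff _ _ _ _ _ _ _ (is_diff_coord 0 j (lowh_differentiable (Sseg t t01)))).
  have c01' : 0 <= c <= 1 by case/andP: c01 => /ltW-> /ltW->.
  have Hc := is_diff_coord 0 j (lowh_differentiable (Sseg c c01')).
  have := Hj _ _ _ _ (seg c c01').
  move: E; rewrite (@diff_val _ _ _ _ _ _ _ Hc) -mul_jacobian => <-.
  by rewrite -zE hz hy subrr mulr0 ltxx.
- have [c c01 E] : exists2 c : R, 0 < c < 1 &
      lowg P x (y + u) 0 i - lowg P x y 0 i =
      'd (fun y' => lowg P x y' 0 i) (y + c *: u) u.
    apply: (mean_value (f := fun y' => lowg P x y' 0 i)) => t t01.
    exact: (@ex_diff _ _ _ _ _ _ _ (is_diff_coord 0 i (lowg_differentiable (Sseg t t01)))).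
  have c01' : 0 <= c <= 1 by case/andP: c01 => /ltW-> /ltW->.
  have Hc := is_diff_coord 0 i (lowg_differentiable (Sseg c c01')).
  have := Hi _ _ _ _ (seg c c01').
  move: E; rewrite (@diff_val _ _ _ _ _ _ _ Hc) -mul_jacobian => <-.
  have [/(_ iA) xii _] := Ha _ _ _ _ xe i.
  have := KKT_complementary i K => /eqP; rewrite mulf_eq0 gt_eqF//= => /eqP ->.
  by rewrite subr0 -zE ltNge gz.
- have [c c01 E] : exists2 c : R, 0 < c < 1 &
      lowf P x (y + u) - lowf P x y = 'd (lowf P x) (y + c *: u) u.
    by apply: mean_value => t /Sseg; exact: lowf_differentiable.
  have c01' : 0 <= c <= 1 by case/andP: c01 => /ltW-> /ltW->.
  have := Hf _ _ _ _ (seg c c01').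
  rewrite dotp_grad; last exact/lowf_differentiable/Sseg.
  by rewrite -E -zE subr_gt0.
- pose La y' := lagrangian P x y' mu xi.
  have [c c01 E] : exists2 c : R, 0 < c < 1 &
      La (y + u) - La y = 'd La (y + c *: u) u.
    apply: (mean_value (f := La)) => t /Sseg St.
    exact: (@ex_diff _ _ _ _ _ _ _ (lagrangian_is_diff mu xi St)).
  have c01' : 0 <= c <= 1 by case/andP: c01 => /ltW-> /ltW->.
  have c0 : 0 < c by case/andP: c01.
  have uc : continuous (dotp u : 'rV[R]_m -> R) by exact: linear_row_continuous.
  (* the gradient vanishes at y, so its value at y + c u is a second derivative *)
  have gd (t : R) : 0 <= t <= 1 -> is_diff (y + t *: (c *: u))
      (dotp u \o grad La) (dotp u \o 'd (grad La) (y + t *: (c *: u))).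
    move=> /andP[t0 t1]; rewrite scalerA.
    have St : smooth_lower P x (y + (t * c) *: u).
      by apply: Sseg; rewrite mulr_ge0 ?(ltW c0)//= mulr_ile1 ?(ltW c0)//; case/andP: c01'.
    apply: (is_diff_lin_comp uc).
    exact: (@ex_diff _ _ _ _ _ _ _ (grad_lagrangian_is_diff mu xi St)).
  have [b b01 E2] : exists2 b : R, 0 < b < 1 &
      (dotp u \o grad La) (y + c *: u) - (dotp u \o grad La) y =
      'd (dotp u \o grad La) (y + b *: (c *: u)) (c *: u).
    apply: (mean_value (f := dotp u \o grad La)) => t t01.
    exact: (@ex_diff _ _ _ _ _ _ _ (gd t t01)).
  have b01' : 0 <= b <= 1 by case/andP: b01 => /ltW-> /ltW->.
  have bc01 : 0 <= b * c <= 1.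
    case/andP: b01' c01' => b0 b1 /andP[c0' c1].
    by rewrite mulr_ge0//= mulr_ile1.
  rewrite (@diff_val _ _ _ _ _ _ _ (gd b b01')) /= in E2.
  have gL0 : grad La y = 0 by case: K.
  rewrite gL0 linear0 subr0 linearZ -mul_jacobian linearZ /= scalerA in E2.
  have Lpos : 0 < La (y + u) - La y.
    rewrite E -dotp_grad; last first.
      exact: (@ex_diff _ _ _ _ _ _ _ (lagrangian_is_diff mu xi (Sseg c c01'))).
    rewrite dotpC E2 -[_ *: _]/(c * _) dotpC pmulr_rgt0//.
    exact: HL _ _ _ _ (seg _ bc01).
  have xig : dotp xi (lowg P x z) <= 0.
    by apply: sumr_le0 => i _; rewrite mulr_ge0_le0.
  have xigy : dotp xi (lowg P x y) = 0 by case: K.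
  move: Lpos; rewrite -zE /La /lagrangian hz hy xigy linear0 !addr0.
  lra.
Qed.

End NearReference2.

(** * Euclidean norm and projection onto the orthant *)

Section EuclideanNorm.
Context {R : realType}.

Lemma dotp_ge0 k (u : 'rV[R]_k) : 0 <= dotp u u.
Proof. by apply: sumr_ge0 => i _; rewrite -expr2 sqr_ge0. Qed.

Lemma dotp_le0 k (u : 'rV[R]_k) : dotp u u <= 0 -> u = 0.
Proof.
move=> u0; have {}u0 : \sum_i u 0 i * u 0 i = 0.
  by apply/le_anti; rewrite u0 dotp_ge0.
apply/rowP => i; rewrite mxE; apply/eqP; rewrite -[_ == _]orbb -mulf_eq0.
apply/eqP; apply: (psumr_eq0P _ u0) => // j _.
by rewrite -expr2 sqr_ge0.
Qed.

Lemma norm_le_enorm k (u : 'rV[R]_k) : `|u| <= enorm u.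
Proof.
apply: row_norm_le; first exact: sqrtr_ge0.
move=> i; rewrite -sqrtr_sqr ler_wsqrtr// expr2 /dotp (bigD1 i)//= lerDl.
by apply: sumr_ge0 => j _; rewrite -expr2 sqr_ge0.
Qed.

(** The factor k + 1 instead of the square root of k is positive for k = 0
    too, so that one may divide by it. *)
Lemma enorm_le_norm k (u : 'rV[R]_k) : enorm u <= k.+1%:R * `|u|.
Proof.
have k1 : 0 <= k.+1%:R * `|u| by rewrite mulr_ge0.
rewrite -[leRHS]ger0_norm// -sqrtr_sqr ler_wsqrtr//.
apply: (@le_trans _ _ (\sum_(i < k) `|u| ^+ 2)).
  apply: ler_sum => i _; rewrite -expr2 -real_normK ?num_real//.
  by rewrite lerXn2r ?nnegrE// ler_row_norm.
rewrite sumr_const card_ord -[leLHS]mulr_natl exprMn ler_wpM2r ?sqr_ge0// -natrX ler_nat.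
by rewrite (leq_trans (leqnSn k))// -{1}[k.+1]expn1 leq_pexp2l.
Qed.

Lemma eball_norm k (z w : 'rV[R]_k) (d : R) : eball z d w -> `|w - z| <= d.
Proof. by move=> H; exact: le_trans (norm_le_enorm _) H. Qed.

Lemma norm_eball k (z w : 'rV[R]_k) (d : R) :
  `|w - z| <= d / k.+1%:R -> eball z d w.
Proof.
move=> H; apply: (le_trans (enorm_le_norm _)).
by rewrite mulrC -ler_pdivlMr.
Qed.

Lemma eball_center k (z : 'rV[R]_k) (d : R) : 0 <= d -> eball z d z.
Proof. by move=> d0; apply: norm_eball; rewrite subrr normr0 divr_ge0. Qed.

(** For [w] in the orthant and [pv] the truncation of [v], the squared
    distances satisfy |v - w|^2 >= |v - pv|^2 + |w - pv|^2, coordinate by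
    coordinate. This gives both that [pv] is nearest and that it is the only
    nearest point. *)
Lemma eproj_nonpos k (v : 'rV[R]_k) :
  eproj (@nonpos_orthant R k) v = \row_i Num.min (v 0 i) 0.
Proof.
set pv := \row_i _.
have pvA : @nonpos_orthant R k pv by move=> i; rewrite mxE ge_min lexx orbT.
have pyth w : @nonpos_orthant R k w ->
    dotp (v - pv) (v - pv) + dotp (w - pv) (w - pv) <= dotp (v - w) (v - w).
  move=> wA; rewrite -big_split /=; apply: ler_sum => i _.
  have wi := wA i; rewrite !mxE; case: (leP (v 0 i) 0) => vi; nra.
apply: xget_unique.
  split => // w /pyth H; apply: ler_wsqrtr.
  by apply: le_trans H; rewrite lerDl dotp_ge0.
move=> w [wA /(_ _ pvA) wmin]; apply/eqP; rewrite -subr_eq0; apply/eqP/dotp_le0.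
have wmin' : dotp (v - w) (v - w) <= dotp (v - pv) (v - pv).
  by move: wmin; rewrite /enorm ler_sqrt// dotp_ge0.
have := pyth w wA; lra.
Qed.

Lemma complementarity_eproj k (g xi : 'rV[R]_k) :
  g - eproj (@nonpos_orthant R k) (g + xi) = 0 <->
  forall i, [/\ g 0 i <= 0, 0 <= xi 0 i & xi 0 i * g 0 i = 0].
Proof.
rewrite eproj_nonpos; split.
  move=> /rowP H i; have := H i; rewrite !mxE.
  case: (leP (g 0 i + xi 0 i) 0) => gx E.
    have xi0 : xi 0 i = 0 by lra.
    by rewrite xi0 mul0r lexx; split => //; lra.
  have g0 : g 0 i = 0 by lra.
  by rewrite g0 mulr0 lexx; split => //; lra.
move=> H; apply/rowP => i; have [gi xii /eqP] := H i; rewrite !mxE mulf_eq0.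
by move=> /orP[]/eqP E; case: (leP (g 0 i + xi 0 i) 0) => gx; lra.
Qed.

End EuclideanNorm.

(** * The solution map *)

Section SolutionMap.
Context {R : realType} (n m p q r s : nat) (P : bilevel R n m p q r s).
Variables (xs : 'rV[R]_n) (ys : 'rV[R]_m) (mus : 'rV[R]_r) (xis : 'rV[R]_s).
Hypothesis S : smooth_lower P xs ys.
Hypothesis JU : jacobian_uniqueness P xs ys mus xis.

Local Notation U := 'rV[R]_(m + (r + s)).
Local Notation near_ref := (near_ref xs ys mus xis).

Lemma kkt_map_ref : kkt_map P (xs, pack ys mus xis) = 0.
Proof.
have [K _ _ _] := JU; apply/(kkt_map_eq0 mus xis S).
by split; [case: K|case: K|move=> i; exact: (KKT_complementary i K)].
Qed.

Lemma implicit_solution : exists phi : 'rV[R]_n -> U, exists2 e : R, 0 < e &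
  [/\ phi xs = pack ys mus xis, C1_around phi xs,
     (\forall x \near xs, kkt_map P (x, phi x) = 0 /\
        forall v, dif (kkt_map P) (x, phi x) (0, v) = 0 -> v = 0) &
     forall x u, `|x - xs| < e -> `|u - pack ys mus xis| < e ->
       kkt_map P (x, u) = 0 -> u = phi x].
Proof.
apply: implicit_function; [exact: kkt_map_C1|exact: kkt_map_ref|].
by move=> v; exact: jacobian_uniqueness_injective.
Qed.

Lemma continuous_near_dist k (f : 'rV[R]_n -> 'rV[R]_k) (e : R) :
  {for xs, continuous f} -> 0 < e -> \forall x \near xs, `|f x - f xs| < e.
Proof.
move=> fc e0; have /cvgrPdist_lt/(_ e e0) := fc.
by apply: filterS => x; rewrite distrC.
Qed.

Lemma near_ref_continuous (e : R) ysol musol xisol :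
  0 < e -> (ysol xs, musol xs, xisol xs) = (ys, mus, xis) ->
  C1_around ysol xs -> C1_around musol xs -> C1_around xisol xs ->
  \forall x \near xs, near_ref e x (ysol x) (musol x) (xisol x).
Proof.
move=> e0 [<- <- <-] /C1_continuous yc /C1_continuous muc /C1_continuous xic.
have xe : \forall x \near xs, `|x - xs| < e by exact: (ball_near e0).
near=> x; split.
- by near: x.
- near: x; exact: continuous_near_dist.
- near: x; exact: continuous_near_dist.
- near: x; exact: continuous_near_dist.
Unshelve. all: by end_near. Qed.

Theorem solution_map_exists : exists delta1 eps1 ysol musol xisol,
  solution_map P xs ys mus xis delta1 eps1 ysol musol xisol.
Proof.
have [phi [e1 e10 [phi0 phiC phiK _]]] := implicit_solution.
have [e e0 JUe] := jacobian_uniqueness_near S JU.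
pose Ly : {linear U -> 'rV[R]_m} := lsubmx.
pose Lmu : {linear U -> 'rV[R]_r} := lsubmx \o rsubmx.
pose Lxi : {linear U -> 'rV[R]_s} := rsubmx \o rsubmx.
have phiE x : phi x = pack (Ly (phi x)) (Lmu (phi x)) (Lxi (phi x)).
  by rewrite /pack /= !hsubmxK.
have val0 : ((Ly \o phi) xs, (Lmu \o phi) xs, (Lxi \o phi) xs) = (ys, mus, xis).
  by rewrite /= phi0 /pack row_mxKl !row_mxKr row_mxKl.
have C1_part k (L : {linear U -> 'rV[R]_k}) x :
    C1_around phi x -> C1_around (L \o phi) x.
  by move=> phiCx; apply: C1_lin_comp => //; exact: linear_row_continuous.
have nearK := near_ref_continuous e0 val0 (C1_part _ Ly _ phiC)
  (C1_part _ Lmu _ phiC) (C1_part _ Lxi _ phiC).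
have near1 := near_ref_continuous ltr01 val0 (C1_part _ Ly _ phiC)
  (C1_part _ Lmu _ phiC) (C1_part _ Lxi _ phiC).
have [d d0 Hd] := near_ball (filterI (filterI nearK near1)
  (filterI phiK (C1_around_near phiC))).
(* a sup norm below 1 in dimension k is a Euclidean norm of at most k + 1 *)
exists (d / 2), (m + r + s).+1%:R, (Ly \o phi), (Lmu \o phi), (Lxi \o phi).
split => //; first by rewrite divr_gt0.
move=> x /eball_norm xd.
have {}xd : `|x - xs| < d by apply: le_lt_trans xd _; rewrite ltr_pdivrMr// ltr_pMr// ltr1n.
have [[nK n1] [[K0 inj] phiCx]] := Hd x xd.
have [_ y1 mu1 xi1] := n1.
have eps k (z w : 'rV[R]_k) : (k <= m + r + s)%N -> `|w - z| < 1 ->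
    eball z (m + r + s).+1%:R w.
  move=> km wz; apply: norm_eball; apply: (le_trans (ltW wz)).
  by rewrite ler_pdivlMr// mul1r ler_nat.
split.
- by apply: eps => //; rewrite -addnA leq_addr.
- by apply: eps => //; rewrite addnAC leq_addl.
- by apply: eps => //; rewrite leq_addl.
- by split; exact: C1_part.
- by move: K0 inj; rewrite phiE => K0 inj; exact: (JUe _ _ _ _ nK K0 inj).
Qed.

Lemma kkt_unique : exists2 e : R, 0 < e & forall x y mu xi y' mu' xi',
  near_ref e x y mu xi -> near_ref e x y' mu' xi' ->
  kkt_map P (x, pack y mu xi) = 0 -> kkt_map P (x, pack y' mu' xi') = 0 -> y = y'.
Proof.
have [phi [e e0 [_ _ _ uniq]]] := implicit_solution.
exists e => // x y mu xi y' mu' xi' xe xe' K K'.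
have ue y0 mu0 xi0 : near_ref e x y0 mu0 xi0 ->
    `|pack y0 mu0 xi0 - pack ys mus xis| < e.
  by move=> /near_ref_pack; rewrite prod_normE /= gt_max => /andP[].
have xe1 : `|x - xs| < e by case: xe.
have E : pack y mu xi = pack y' mu' xi'.
  by rewrite (uniq x _ xe1 (ue _ _ _ xe) K) (uniq x _ xe1 (ue _ _ _ xe') K').
have := congr1 (@lsubmx _ _ m (r + s)) E.
by rewrite /pack !row_mxKl.
Qed.

End SolutionMap.

(** * Equivalence of the three problems *)

Section Equivalence.
Context {R : realType} (n m p q r s : nat) (P : bilevel R n m p q r s).
Variables (xs : 'rV[R]_n) (ys : 'rV[R]_m) (mus : 'rV[R]_r) (xis : 'rV[R]_s).
Hypothesis S : smooth_lower P xs ys.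
Hypothesis JU : jacobian_uniqueness P xs ys mus xis.

Local Notation near_ref := (near_ref xs ys mus xis).

Lemma FP_feasible_kkt_map x y mu xi : smooth_lower P x y ->
  FP_feasible P (x, y, mu, xi) -> kkt_map P (x, pack y mu xi) = 0.
Proof.
move=> Sx [_ _ gL h0 /complementarity_eproj gx].
by apply/(kkt_map_eq0 mu xi Sx); split => // i; have [_ _] := gx i.
Qed.

Lemma KKT_kkt_map x y mu xi : smooth_lower P x y ->
  KKT P x y mu xi -> kkt_map P (x, pack y mu xi) = 0.
Proof.
move=> Sx K; apply/(kkt_map_eq0 mu xi Sx).
by split; [case: K|case: K|move=> i; exact: (KKT_complementary i K)].
Qed.

Lemma KKT_FP_feasible x y mu xi : upH P x y = 0 -> (forall i, upG P x y 0 i <= 0) ->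
  KKT P x y mu xi -> FP_feasible P (x, y, mu, xi).
Proof.
move=> H0 G0 K; have [gL h0 xi0 g0 _] := K; split => //.
by apply/complementarity_eproj => i; split => //; exact: (KKT_complementary i K).
Qed.

Variables (delta1 eps1 : R) (ysol : 'rV[R]_n -> 'rV[R]_m).
Variables (musol : 'rV[R]_n -> 'rV[R]_r) (xisol : 'rV[R]_n -> 'rV[R]_s).
Hypothesis SM : solution_map P xs ys mus xis delta1 eps1 ysol musol xisol.

Lemma ysol_ref : ysol xs = ys.
Proof. by have [_ _ [-> _ _] _] := SM. Qed.

Lemma solution_ref_ball : eball xs delta1 xs.
Proof. by have [d0 _ _ _] := SM; apply: eball_center; exact: ltW. Qed.

Lemma solution_C1 :
  [/\ C1_around ysol xs, C1_around musol xs & C1_around xisol xs].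
Proof. by have [_ _ _ /(_ _ solution_ref_ball)[]] := SM. Qed.

Lemma solution_KKT x : eball xs delta1 x -> KKT P x (ysol x) (musol x) (xisol x).
Proof. by have [_ _ _ H] := SM; move=> /H[_ _ _ _ []]. Qed.

Lemma solution_near (e : R) : 0 < e -> exists2 d : R, 0 < d & forall x,
  `|x - xs| < d -> near_ref e x (ysol x) (musol x) (xisol x) /\ eball xs delta1 x.
Proof.
move=> e0; have [d10 _ sol0 _] := SM; have [yC muC xiC] := solution_C1.
have [d d0 Hd] := near_ball (near_ref_continuous e0 sol0 yC muC xiC).
exists (Num.min d (delta1 / n.+1%:R)); first by rewrite lt_min d0 divr_gt0.
move=> x; rewrite lt_min => /andP[/Hd xe xd]; split => //.
exact/norm_eball/ltW.
Qed.

Lemma solution_feasible x : eball xs delta1 x -> Y P x (ysol x).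
Proof. by move=> /solution_KKT[]. Qed.

(** A point feasible for (FP) near the reference point is a zero of
    [kkt_map], and so is the point of the solution branch over the same x;
    by uniqueness they have the same y. *)
Lemma SP_local_FP_local : SP_local_solution P xs delta1 ysol ->
  FP_local_solution P xs ys mus xis.
Proof.
move=> [[_]]; rewrite ysol_ref => H0 G0 /near_ball[d1 d10 SPmin]; split.
  by apply: KKT_FP_feasible => //; case: JU.
have [e1 e10 Hs] := smooth_near S.
have [e2 e20 uniq] := kkt_unique S JU.
pose e3 := Num.min e1 e2.
have e30 : 0 < e3 by rewrite lt_min e10.
have [d2 d20 Hsol] := solution_near e30.
pose d := Num.min (Num.min d1 d2) e3.
have d0 : 0 < d by rewrite 2!lt_min d10 d20 e30.
apply/nbhs_ballP; exists d => // -[[[x y] mu] xi] [[[xd yd] mud] xid] FPx.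
move: xd yd mud xid; rewrite -!ball_normE /= ![`|_ - x|]distrC ![`|_ - y|]distrC
  ![`|_ - mu|]distrC ![`|_ - xi|]distrC !lt_min.
move=> /andP[/andP[xd1 xd2] /andP[xe1 xe2]] /andP[_ /andP[ye1 ye2]].
move=> /andP[_ /andP[mue1 mue2]] /andP[_ /andP[xie1 xie2]].
have [nsol xball] := Hsol x xd2.
have nsol2 : near_ref e2 x (ysol x) (musol x) (xisol x).
  by apply: near_ref_le nsol; rewrite ge_min lexx orbT.
have [_ ysole _ _] : near_ref e1 x (ysol x) (musol x) (xisol x).
  by apply: near_ref_le nsol; rewrite ge_min lexx.
have yE : y = ysol x.
  apply: (uniq x y mu xi (ysol x) (musol x) (xisol x)) => //.
    by apply: FP_feasible_kkt_map => //; exact: Hs.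
  by apply: KKT_kkt_map; [exact: Hs|exact: solution_KKT].
have [Hx Gx _ _ _] := FPx.
have := SPmin x xd1; rewrite -yE; apply.
by split; rewrite -?yE.
Qed.

Lemma FP_local_SP_local : FP_local_solution P xs ys mus xis ->
  SP_local_solution P xs delta1 ysol.
Proof.
move=> [[H0 G0 _ _ _] /nbhs_ballP[d /= d0 FPmin]]; split.
  by split; rewrite ?ysol_ref//; exact: solution_ref_ball.
have [d1 d10 Hsol] := solution_near d0.
apply: (ball_near d10) => x xd [xball Hx Gx]; rewrite ysol_ref.
have [[xe ye mue xie] _] := Hsol x xd.
have bx : ball xs d x by rewrite -ball_normE /= distrC.
have bys : ball ys d (ysol x) by rewrite -ball_normE /= distrC.
have bmu : ball mus d (musol x) by rewrite -ball_normE /= distrC.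
have bxi : ball xis d (xisol x) by rewrite -ball_normE /= distrC.
apply: (FPmin (x, ysol x, musol x, xisol x) (conj (conj (conj bx bys) bmu) bxi)).
by apply: KKT_FP_feasible => //; exact: solution_KKT.
Qed.

(** Fix one [delta] for which [eta delta] is below the radius of
    [strict_minimality]. For x near [xs] the point [ysol x] minimises f(x, _) on
    the feasible points of the ball of radius [eta delta], so it competes in the
    definition of a bi-local solution. *)
Lemma bilocal_SP_local : bilocal_solution P xs ys ->
  SP_local_solution P xs delta1 ysol.
Proof.
move=> [[H0 G0] _ [delta0 [eta [delta00 eta_gt0 eta0 bil]]]].
split; first by split; rewrite ?ysol_ref//; exact: solution_ref_ball.
have [e e0 strict] := strict_minimality S JU.
have [delta [d0 dd0 etae]] : exists delta : R,
    [/\ 0 < delta, delta <= delta0 & eta delta < e].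
  have small : \forall delta \near (0 : R)^'+, `|0 - eta delta| < e.
    by move/cvgrPdist_lt : eta0; exact.
  have pos : \forall delta \near (0 : R)^'+, 0 < delta by exact: nbhs_right_gt.
  have le0 : \forall delta \near (0 : R)^'+, delta < delta0 by exact: nbhs_right_lt.
  have ok : \forall delta \near (0 : R)^'+,
      [/\ `|0 - eta delta| < e, 0 < delta & delta < delta0].
    near=> delta; split; near: delta; [exact: small|exact: pos|exact: le0].
  have [delta [sm dp /ltW dd0]] :=
    @filter_ex _ _ (at_right_proper_filter 0) _ ok.
  exists delta; split => //; move: sm; rewrite sub0r normrN.
  exact/le_lt_trans/ler_norm.
have dlt : 0 < delta <= delta0 by rewrite d0.
have eta1 := eta_gt0 delta dlt.
have [_ bilmin] := bil delta dlt.
pose e1 := Num.min e (eta delta / m.+1%:R).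
have e10 : 0 < e1 by rewrite lt_min e0 divr_gt0.
have [d1 d10 Hsol] := solution_near e10.
pose d2 := Num.min d1 (delta / n.+1%:R).
have d20 : 0 < d2 by rewrite lt_min d10 divr_gt0.
apply: (ball_near d20) => x; rewrite lt_min => /andP[/Hsol[nsol _] xd] [xball Hx Gx].
rewrite ysol_ref; apply: bilmin.
  split => //; split; first exact/norm_eball/ltW.
  apply: norm_eball; case: nsol => _ /ltW yb _ _; apply: le_trans yb _.
  by rewrite ge_min lexx orbT.
split.
  split; first exact: solution_feasible.
  apply: norm_eball; case: nsol => _ /ltW yb _ _; apply: le_trans yb _.
  by rewrite ge_min lexx orbT.
move=> z [Yz /eball_norm zeta]; have [->//|zy] := eqVneq z (ysol x).
apply/ltW/(strict x _ (musol x) (xisol x)) => //.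
- by apply: near_ref_le nsol; rewrite ge_min lexx.
- exact: le_lt_trans etae.
- exact: solution_KKT.
Unshelve. all: by end_near. Qed.

(** [ysol] is Lipschitz at [xs], so the ball of radius [C * delta] contains
    [ysol x] whenever x is within [delta] of [xs]. For small [delta] this radius is
    below that of [strict_minimality], which makes [ysol x] the only minimiser
    over the ball. *)
Lemma SP_local_bilocal : SP_local_solution P xs delta1 ysol ->
  bilocal_solution P xs ys.
Proof.
move=> [[_]]; rewrite ysol_ref => H0 G0 /near_ball[d1 d10 SPmin].
split => //; first by rewrite -ysol_ref; exact: solution_feasible solution_ref_ball.
have [e e0 strict] := strict_minimality S JU.
have [d2 d20 Hsol] := solution_near e0.
have [yC _ _] := solution_C1.
have [k k0 /near_ball[d3 d30 lip]] :=
  differentiable_locally_lipschitz (C1_differentiable yC).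
pose C := m.+1%:R * k.
have C0 : 0 < C by rewrite mulr_gt0.
pose d := Num.min (Num.min d1 d2) d3.
have d0 : 0 < d by rewrite !lt_min d10 d20.
(* halved because the Euclidean balls are closed and the other bounds are strict *)
pose delta0 := Num.min (d / 2) (e / (C * 2)).
exists delta0, (fun delta => C * delta).
have delta00 : 0 < delta0 by rewrite lt_min !divr_gt0// mulr_gt0.
split => //.
- by move=> delta /andP[dp _]; rewrite mulr_gt0.
- rewrite -[X in _ --> X](mulr0 C); apply: cvgM; first exact: cvg_cst.
  exact/cvg_at_right_filter/cvg_id.
move=> delta /andP[dp]; rewrite le_min => /andP[dd de].
have etae : C * delta < e.
  have : C * delta <= C * (e / (C * 2)) by rewrite ler_wpM2l// ltW.
  have -> : C * (e / (C * 2)) = e / 2 by field; rewrite gt_eqF.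
  lra.
have dltd : delta < d by lra.
have KKTs : KKT P xs ys mus xis by case: JU.
split.
  move=> z [Yz /eball_norm zeta]; have [->//|zy] := eqVneq z ys.
  apply/ltW/(strict xs ys mus xis) => //.
    by split; rewrite subrr normr0.
  exact: le_lt_trans etae.
move=> x y [[Hx Gx] [/= /eball_norm xd ydelta]] [[Yy _] ymin].
have := le_lt_trans xd dltd; rewrite !lt_min => /andP[/andP[xd1 xd2] xd3].
have [nsol xball] := Hsol x xd2.
have ysolb : eball ys (C * delta) (ysol x).
  rewrite /eball /= -ysol_ref; apply: (le_trans (enorm_le_norm _)).
  rewrite /C -mulrA ler_wpM2l//; apply: (le_trans (lip x xd3)).
  by rewrite ler_wpM2l// ltW.
have yE : y = ysol x.
  apply/eqP/negPn/negP => yn.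
  have := ymin (ysol x) (conj (solution_feasible xball) ysolb).
  rewrite leNgt => /negP; apply.
  apply: (strict x _ (musol x) (xisol x)) => //.
    by apply: le_lt_trans etae; exact: eball_norm.
  exact: solution_KKT.
have := SPmin x xd1; rewrite -yE; apply.
by split; rewrite -?yE.
Qed.

End Equivalence.

Theorem theorem4p1 (R : realType) (n m p q r s : nat)
    (P : bilevel R n m p q r s)
    (xs : 'rV[R]_n) (ys : 'rV[R]_m) (mus : 'rV[R]_r) (xis : 'rV[R]_s)
    (Psmooth : smooth_lower P xs ys)
    (Pjuc : jacobian_uniqueness P xs ys mus xis) :
  (exists delta1 eps1 ysol musol xisol,
     solution_map P xs ys mus xis delta1 eps1 ysol musol xisol) /\
  (forall delta1 eps1 ysol musol xisol,
     solution_map P xs ys mus xis delta1 eps1 ysol musol xisol ->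
     [<-> bilocal_solution P xs ys;
          SP_local_solution P xs delta1 ysol;
          FP_local_solution P xs ys mus xis]).
Proof.
split; first exact: solution_map_exists.
move=> delta1 eps1 ysol musol xisol SM; tfae.
- exact: bilocal_SP_local SM.
- exact: SP_local_FP_local SM.
- by move=> /(FP_local_SP_local SM)/(SP_local_bilocal Psmooth Pjuc SM).
Qed.
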